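(* For every $n\ge1$, the class $\mathcal{Q}_n$ is closed under quiver mutation: if $Q\in\mathcal{Q}_n$ and $i$ is a vertex of $Q$, then the mutation of $Q$ at $i$ is again in $\mathcal{Q}_n$.
   Context: Quivers and mutation. A quiver is a finite directed graph. Let $Q$ be a quiver without loops and oriented $2$-cycles. The mutation of $Q$ at a vertex $k$ is the quiver $Q^*$ obtained as follows: add a new vertex $k^*$; if there are $r>0$ arrows $i\to k$, $s>0$ arrows $k\to j$ and $t\in\mathbb{Z}$ arrows $j\to i$ in $Q$, then there are $t-rs$ arrows $j\to i$ in $Q^*$ (a negative number of arrows means arrows in the opposite direction); for any vertex $i$ replace all arrows $i\to k$ by arrows $k^*\to i$ and all arrows $k\to i$ by arrows $i\to k^*$; remove $k$. Two quivers are mutation equivalent if one can be obtained (up to isomorphism) from the other by a finite sequence of mutations. A non-oriented cycle of length $m\ge 2$ is a quiver whose underlying graph is a cycle with $m$ vertices and $m$ edges (for $m=2$, a double arrow) and which is not an oriented cycle. Quivers of type $A_k$. Below, a quiver of type $A_k$ means a quiver mutation equivalent to an orientation of the Dynkin diagram $A_k$; equivalently (Buan-Vatne), a connected quiver with $k$ vertices such that all non-trivial cycles in the underlying graph (not passing through the same edge twice) are oriented and of length $3$; each vertex has at most four incident arrows; if a vertex has four incident arrows, two of them belong to one oriented $3$-cycle and the other two to another oriented $3$-cycle; if a vertex has three incident arrows, two of them belong to an oriented $3$-cycle and the third does not belong to any oriented $3$-cycle. The class $\mathcal{Q}_n$. It is the class of connected quivers $Q$ with $n+1$ vertices such that: (i)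 there is precisely one full subquiver which is a non-oriented cycle of length $\ge 2$ (if the length is two, it is a double arrow); (ii) for each arrow $\alpha: x\to y$ of this non-oriented cycle there may (or may not) be a vertex $z_\alpha$ not on the non-oriented cycle such that there is an oriented $3$-cycle $x\xrightarrow{\alpha} y\to z_\alpha\to x$, and apart from the arrows of these oriented $3$-cycles there are no other arrows incident to vertices on the non-oriented cycle; (iii) if all vertices of the non-oriented cycle and their incident arrows are removed, the result is a disjoint union of quivers $Q_\alpha$, one for each $z_\alpha$ (with $z_\alpha$ a vertex of $Q_\alpha$), each $Q_\alpha$ is a quiver of type $A_{k_\alpha}$ for some $k_\alpha\ge1$, the vertex $z_\alpha$ has at most two incident arrows in $Q_\alpha$, and if it has two, then $z_\alpha$ is a vertex of an oriented $3$-cycle in $Q_\alpha$. Convention: if the non-oriented cycle is a double arrow, only one of the two arrows is chosen to be part of the oriented $3$-cycle through a given vertex $z_\alpha$ (different vertices $z$ being attached to different arrows). *)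

(* Defs.v *)
From HB Require Import structures.
From mathcomp Require Import all_boot all_order all_algebra.
From mathcomp Require Import zify.

Set Implicit Arguments.
Unset Strict Implicit.
Unset Printing Implicit Defensive.

(** A quiver without loops and oriented 2-cycles on the finite vertex set [T],
    given by its numbers of arrows: [arr Q x y] is the number of arrows
    [x -> y]. *)
Record quiver (T : finType) := Quiver {
  arr : T -> T -> nat;
  arr_loopless : forall x, arr x x = 0;
  arr_no2cycle : forall x y, 0 < arr x y -> arr y x = 0
}.

(** The individual arrows; [arrow Q] is a finType, and a double arrow
    [x => y] gives two elements of it. *)
Definition arrow (T : finType) (Q : quiver T) :=
  {xy : T * T & 'I_(arr Q xy.1 xy.2)}.

Definition src (T : finType) (Q : quiver T) (a : arrow Q) : T := (tag a).1.
Definition tgt (T : finType) (Q : quiver T) (a : arrow Q) : T := (tag a).2.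

Definition nedges (T : finType) (Q : quiver T) (x y : T) : nat :=
  arr Q x y + arr Q y x.

(** Number of arrows incident to [x] (there are no loops). *)
Definition valency (T : finType) (Q : quiver T) (x : T) : nat :=
  \sum_(y : T) nedges Q x y.

Definition connected (T : finType) (Q : quiver T) : Prop :=
  forall x y : T, connect (fun u v => 0 < nedges Q u v) x y.

Definition iso (T T' : finType) (Q : quiver T) (Q' : quiver T') : Prop :=
  exists f : T -> T',
    bijective f /\ forall x y, arr Q' (f x) (f y) = arr Q x y.

Section FullSubquiver.

Variables (T : finType) (Q : quiver T) (A : {set T}).

Definition full_arr (x y : {x : T | x \in A}) : nat := arr Q (val x) (val y).

Lemma full_loopless x : full_arr x x = 0.
Proof. exact: arr_loopless. Qed.

Lemma full_no2cycle x y : 0 < full_arr x y -> full_arr y x = 0.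
Proof. exact: arr_no2cycle. Qed.

Definition full_subquiver : quiver {x : T | x \in A} :=
  Quiver full_loopless full_no2cycle.

End FullSubquiver.

Section Mutation.

Variables (T : finType) (Q : quiver T) (k : T).

(** The new vertex [k*] is again called [k].  For [i, j] different from [k],
    the signed number of arrows [j -> i] after mutation is [t - r s] when there
    are [r] arrows [i -> k] and [s] arrows [k -> j], and [t + r s] when there
    are [r] arrows [k -> i] and [s] arrows [j -> k], where
    [t = arr Q j i - arr Q i j].  The truncated subtraction below takes the
    positive part of this integer; see [mutation_net]. *)
Definition mut_arr (j i : T) : nat :=
  if (j == k) || (i == k) then arr Q i j
  else (arr Q j i + arr Q j k * arr Q k i) - (arr Q i j + arr Q i k * arr Q k j).

Lemma mut_loopless x : mut_arr x x = 0.
Proof. by rewrite /mut_arr arr_loopless subnn; case: ifP. Qed.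

Lemma mut_no2cycle x y : 0 < mut_arr x y -> mut_arr y x = 0.
Proof.
rewrite /mut_arr orbC; case: ifP => _; first exact: arr_no2cycle.
by rewrite subn_gt0 => /ltnW; rewrite -subn_eq0 => /eqP.
Qed.

Definition mutation : quiver T := Quiver mut_loopless mut_no2cycle.

End Mutation.

Definition net (T : finType) (Q : quiver T) (x y : T) : int :=
  ((arr Q x y)%:Z - (arr Q y x)%:Z)%R.

Lemma mutation_net (T : finType) (Q : quiver T) (k i j : T) :
    i != k -> j != k -> 0 < arr Q i k -> 0 < arr Q k j ->
  net (mutation Q k) j i = (net Q j i - (arr Q i k * arr Q k j)%:Z)%R.
Proof.
move=> /negbTE ik /negbTE jk r s; rewrite /net /= /mut_arr ik jk /=.
rewrite (arr_no2cycle r) (arr_no2cycle s) !muln0 !addn0.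
by lia.
Qed.

Lemma mutation_net_id (T : finType) (Q : quiver T) (k i j : T) :
    i != k -> j != k -> arr Q i k * arr Q k j = 0 ->
    arr Q j k * arr Q k i = 0 ->
  net (mutation Q k) j i = net Q j i.
Proof.
move=> /negbTE ik /negbTE jk r s.
by rewrite /net /= /mut_arr ik jk /= r s; lia.
Qed.

Definition mutation_equivalent (T T' : finType) (Q : quiver T)
    (Q' : quiver T') : Prop :=
  exists s : seq T, iso (foldl (@mutation T) Q s) Q'.

(** Orientations of the Dynkin diagram [A_k] with vertices [0, ..., k - 1]. *)
Definition dynkinA_orientation (k : nat) (R : quiver 'I_k) : Prop :=
  forall i j : 'I_k, nedges R i j = (i.+1 == j :> nat) + (j.+1 == i :> nat).

Definition typeA (k : nat) (T : finType) (Q : quiver T) : Prop :=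
  exists R : quiver 'I_k, dynkinA_orientation R /\ mutation_equivalent R Q.

(** The sequence [c] runs once around the underlying cycle.  For
    [size c = 2] both summands of the edge count are 1, so that the condition
    describes two parallel edges. *)
Definition nonoriented_cycle (T : finType) (Q : quiver T) : Prop :=
  exists c : seq T,
    [/\ uniq c, forall x, x \in c & 2 <= size c] /\
    (forall x y, nedges Q x y = (y == next c x) + (x == next c y)) /\
    ~ (cycle (fun x y => 0 < arr Q x y) c \/
       cycle (fun x y => 0 < arr Q y x) c).

(** The condition on each [Q_alpha] (here [Q]) and its vertex [z_alpha] (here
    [z]). *)
Definition rooted_typeA (T : finType) (Q : quiver T) (z : T) : Prop :=
  [/\ exists2 k, 1 <= k & typeA k Q,
      valency Q z <= 2
    & valency Q z = 2 ->
      exists u v, [/\ 0 < arr Q z u, 0 < arr Q u v & 0 < arr Q v z]].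

(** [C] is the vertex set of the non-oriented cycle, [D] the set of those of
    its arrows [a] that carry an oriented 3-cycle
    [src a -> tgt a -> z a -> src a], and [V a] the vertex set of [Q_a].  As
    [C] spans a full subquiver, the arrows of the cycle are the arrows of [Q]
    with both ends in [C].  The two arrow counts say at once that the arrows
    [tgt a -> z a] and [z a -> src a] exist, are single, and are the only
    arrows between [C] and its complement. *)
Definition classQ (n : nat) (T : finType) (Q : quiver T) : Prop :=
  [/\ #|T| = n.+1, connected Q &
  exists C : {set T},
    (nonoriented_cycle (full_subquiver Q C) /\
     forall C' : {set T}, nonoriented_cycle (full_subquiver Q C') -> C' = C) /\
    exists (D : {set arrow Q}) (z : arrow Q -> T) (V : arrow Q -> {set T}),
      [/\ {in D, forall a, [/\ src a \in C, tgt a \in C & z a \notin C]},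
          {in D &, injective z}
        & forall x w, x \in C -> w \notin C ->
            arr Q x w = [exists a in D, (z a == w) && (tgt a == x)] /\
            arr Q w x = [exists a in D, (z a == w) && (src a == x)]] /\
      [/\ \bigcup_(a in D) V a = ~: C,
          {in D &, forall a b, a != b ->
             [disjoint V a & V b] /\
             {in V a & V b, forall x y, nedges Q x y = 0}}
        & {in D, forall a, exists w : {x : T | x \in V a},
             val w = z a /\ rooted_typeA (full_subquiver Q (V a)) w}]].

(* Main.v *)
Require Import Defs.
From mathcomp Require Import all_boot all_order all_algebra.
From mathcomp Require Import zify.

(** A binary tree encodes a quiver: a node and its two children span an
    oriented 3-cycle (an arrow if a child is missing), so that every vertex lies
    in at most two such blocks.  Mutation at [i] turns the blocks [(i, p, q)] and
    [(i, r, s)] into [(i, q, r)] and [(i, s, p)].  For a vertex below the root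
    this is a tree rotation; since every tree can be rotated into a path, the
    rooted quivers of type A are exactly the trees.  A quiver of the class Q_n is
    a cyclic list of segments, each made of a vertex, a direction and the tree
    hanging on the arrow to the next vertex, and the same exchange of blocks
    lengthens, shortens or redirects the cycle. *)

Set Implicit Arguments.
Unset Strict Implicit.
Unset Printing Implicit Defensive.

(** A vertex below a root lies in two blocks, its parent's and its own (possibly trivial), which is
    why mutation there is a rotation. A root lies in one block only, and the condition on [z_alpha]
    says exactly this: valency at most two, with a 3-cycle when it is two, excludes a second block.
    Mutation cancels arrows in pairs, so blocks are compared through net numbers of arrows; the
    absence of 2-cycles, proved separately for trees and for circuits, turns net numbers into actual
    ones. The exchange of blocks is an identity between counts in which corners may be absent or
    equal, so it covers double arrows without a separate case. Being non-oriented is recorded as: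
    both directions occur along the list. An exchange on the cycle doubles a direction, merges two
    equal ones or swaps two opposite ones, so this persists and the list never shrinks to one
    segment. The cycle is unique because hanging trees can be excluded from the leaves upwards: once
    its subtrees are excluded, a vertex has as neighbours only the other two corners of one block,
    and a cycle through it would be that oriented block. *)

(** * Oriented 3-cycles with possibly missing corners, and mutation as an exchange of two of them *)

Section Blocks.

Variable L : eqType.
Implicit Types (a b c d p q r s : option L) (x y i : L).

Definition link a b x y : nat := (a == Some x) && (b == Some y).

Definition tri a b c x y : nat := link a b x y + link b c x y + link c a x y.

Lemma tri_rot a b c x y : tri a b c x y = tri b c a x y.
Proof. by rewrite /tri -addnA addnC. Qed.

(** Mutation of the net numbers of arrows, with the negative terms moved to the
    other side; [g] need not be free of 2-cycles. *)
Definition mutates (f g : L -> L -> nat) i :=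
  (forall x, g x i = f i x /\ g i x = f x i) /\
  forall x y, x != i -> y != i ->
    f x y + f x i * f i y + g y x = f y x + f y i * f i x + g x y.

(** Arrows leave [i] for [p] and [r] and enter it from [q] and [s]. Of the four paths through [i],
    those from [q] to [p] and from [s] to [r] cancel the third sides of the old blocks; those from
    [q] to [r] and from [s] to [p] create the third sides of the new ones. The four corners may
    coincide or be missing. *)
Lemma mutates_tri i p q r s (f g R : L -> L -> nat) :
  p != Some i -> q != Some i -> r != Some i -> s != Some i ->
  (forall x, R x i = 0 /\ R i x = 0) ->
  (forall x y, f x y = tri (Some i) p q x y + tri (Some i) r s x y + R x y) ->
  (forall x y, g x y = tri (Some i) q r x y + tri (Some i) s p x y + R x y) ->
  mutates f g i.
Proof.
move=> /negbTE pi /negbTE qi /negbTE ri /negbTE si Ri fE gE.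
have ii : Some i == Some i by rewrite eqxx.
split=> [x|x y xi yi].
  rewrite !fE !gE /tri /link; have [-> ->] := Ri x.
  by rewrite pi qi ri si ii !andbF !andbT /=; split; lia.
have ix : (Some i == Some x) = false by apply/negbTE; rewrite eq_sym.
have iy : (Some i == Some y) = false by apply/negbTE; rewrite eq_sym.
have [Rxi Rix] := Ri x; have [Ryi Riy] := Ri y.
rewrite !fE !gE /tri /link Rxi Rix Ryi Riy pi qi ri si ii ix iy.
(* What remains is a polynomial identity in eight indicators, valid for arbitrary natural numbers in
   their place. *)
rewrite !andbF !andbT /= !add0n !addn0 -!mulnb.
move: (nat_of_bool _) (nat_of_bool _) (nat_of_bool _) (nat_of_bool _)
  (nat_of_bool _) (nat_of_bool _) (nat_of_bool _) (nat_of_bool _) => *.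
lia.
Qed.

Lemma mutatesD i (f g f' g' R : L -> L -> nat) :
  mutates f g i -> (forall x, R x i = 0 /\ R i x = 0) ->
  (forall x y, f' x y = f x y + R x y) ->
  (forall x y, g' x y = g x y + R x y) -> mutates f' g' i.
Proof.
move=> [fg0 fg] Ri f'E g'E; split=> [x|x y xi yi].
  by rewrite !f'E !g'E; have [-> ->] := Ri x; have [-> ->] := fg0 x.
rewrite !f'E !g'E; have [-> ->] := Ri x; have [-> ->] := Ri y.
by have := fg x y xi yi; rewrite !addn0; lia.
Qed.

End Blocks.

Definition no2cycle (L : Type) (f : L -> L -> nat) :=
  forall x y, 0 < f x y -> f y x = 0.

(** Net numbers determine the arrows as soon as no pair of vertices has arrows both ways; this
    recovers the truncated subtraction of [mut_arr]. The labelling [h] may miss labels, which leaves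
    room for vertices that are never mutated. *)
Lemma mutation_mutates (L : eqType) (T : finType) (Q : quiver T) (h : T -> L)
    (f g : L -> L -> nat) i :
  injective h -> (forall x y, arr Q x y = f (h x) (h y)) ->
  mutates f g (h i) -> no2cycle g ->
  forall x y, arr (mutation Q i) x y = g (h x) (h y).
Proof.
move=> h_inj QE [fg0 fg] g2 x y; rewrite /= /mut_arr.
case: (eqVneq x i) => [->|xi]; first by have [_ ->] := fg0 (h y); rewrite /= QE.
case: (eqVneq y i) => [->|yi] /=; first by have [-> _] := fg0 (h x); rewrite QE.
have := fg (h x) (h y); rewrite !(inj_eq h_inj) xi yi !QE => /(_ isT isT).
have := g2 (h x) (h y); have := g2 (h y) (h x).
by case: (g (h x) (h y)) => [|m]; case: (g (h y) (h x)) => [|m'] //=; lia.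
Qed.

(** * Binary trees of blocks, rotations, and rotation of a tree into a path *)

Inductive btree (L : Type) := E | N of L & btree L & btree L.
Arguments E {L}.

Section Trees.

Variable L : eqType.
Implicit Types (t A B X Y Z : btree L) (x y z i : L).

Definition troot t : option L := if t is N z _ _ then Some z else None.

Fixpoint lab t : seq L :=
  if t is N z A B then z :: lab A ++ lab B else [::].

Fixpoint tarr t x y : nat :=
  if t is N z A B
  then tri (Some z) (troot A) (troot B) x y + (tarr A x y + tarr B x y) else 0.

Lemma root_lab t x : troot t = Some x -> x \in lab t.
Proof. by case: t => //= z A B [->]; rewrite mem_head. Qed.

Lemma root_notin t x : x \notin lab t -> (troot t == Some x) = false.
Proof. by apply: contraNF => /eqP/root_lab. Qed.

Lemma tarr_notin t x y : (x \notin lab t) || (y \notin lab t) -> tarr t x y = 0.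
Proof.
elim: t => //= z A IHA B IHB; rewrite !inE !mem_cat !negb_or => H.
have zE v : z != v -> (Some z == Some v) = false by move/negbTE.
have HA : (x \notin lab A) || (y \notin lab A).
  by case/orP: H => /and3P[_ -> _]; rewrite ?orbT.
have HB : (x \notin lab B) || (y \notin lab B).
  by case/orP: H => /and3P[_ _ ->]; rewrite ?orbT.
rewrite IHA // IHB // /tri /link.
case/orP: H; rewrite eq_sym => /and3P[/zE -> /root_notin-> /root_notin->];
by rewrite ?andbF.
Qed.

Lemma tarr_lab t x y : 0 < tarr t x y -> (x \in lab t) && (y \in lab t).
Proof.
by case: (boolP (_ && _)) => //; rewrite negb_and => /tarr_notin ->.
Qed.

Lemma tarr_no2cycle t : uniq (lab t) -> no2cycle (tarr t).
Proof.
elim: t => //= z A IHA B IHB /andP[]; rewrite mem_cat negb_or cat_uniq.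
move=> /andP[zA zB] /and3P[uA dAB uB] x y.
(* [code] lists the membership patterns of one vertex that distinct labels rule out. With it and the
   supports of the subtrees' arrows, the claim becomes a finite check. *)
have code v : ~~ [|| (Some z == Some v) && ((v \in lab A) || (v \in lab B)),
    (v \in lab A) && (v \in lab B), (troot A == Some v) && (v \notin lab A)
    | (troot B == Some v) && (v \notin lab B)].
  apply/negP => /or4P[]/andP[].
  - by move=> /eqP[<-]; rewrite (negbTE zA) (negbTE zB).
  - by move=> vA vB; case/hasP: dAB; exists v.
  - by move=> /eqP/root_lab->.
  - by move=> /eqP/root_lab->.
have := IHA uA x y; have := IHB uB x y.
have := @tarr_lab A x y; have := @tarr_lab B x y.
have := @tarr_lab A y x; have := @tarr_lab B y x.
move: (code x) (code y); rewrite /tri /link.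
case: (Some z == Some x); case: (x \in lab A); case: (x \in lab B);
case: (troot A == Some x); case: (troot B == Some x) => //= _;
case: (Some z == Some y); case: (y \in lab A); case: (y \in lab B);
case: (troot A == Some y); case: (troot B == Some y) => //= _; lia.
Qed.

(** Unlike in the usual rotation, [z] stays the parent and [i] moves to its other side, so the label
    of the root never changes. A left child becomes a right child and conversely; a second rotation
    at [i] undoes the first, as for mutation. *)
Inductive rot i : btree L -> btree L -> Prop :=
| rot_out z A B C : rot i (N z (N i A B) C) (N z A (N i B C))
| rot_in z A B C : rot i (N z A (N i B C)) (N z (N i A B) C)
| rot_l z A A' B : rot i A A' -> rot i (N z A B) (N z A' B)
| rot_r z A B B' : rot i B B' -> rot i (N z A B) (N z A B').

Lemma rot_sym i t t' : rot i t t' -> rot i t' t.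
Proof. by elim=> *; by [apply: rot_out|apply: rot_in|apply: rot_l|apply: rot_r]. Qed.

Lemma rot_root i t t' : rot i t t' -> troot t' = troot t.
Proof. by case. Qed.

Lemma rot_lab i t t' : rot i t t' -> perm_eq (lab t') (lab t).
Proof.
elim=> {t t'} [z A B C|z A B C|z A A' B _ /permP IH|z A B B' _ /permP IH];
by apply/permP=> P; rewrite /= ?IH !count_cat /= ?count_cat ?IH; lia.
Qed.

Lemma rot_mem i t t' : rot i t t' -> i \in lab t.
Proof. by elim=> /= *; rewrite !inE ?mem_cat ?inE ?eqxx; lia. Qed.

Lemma rot_exists i t : i \in lab t -> troot t != Some i -> exists t', rot i t t'.
Proof.
elim: t => //= z A IHA B IHB; rewrite inE mem_cat eq_sym => /orP[/eqP ->|].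
  by rewrite eqxx.
case/orP=> iN _.
  case: (eqVneq (troot A) (Some i)) => [|/(IHA iN)[A' ?]]; last first.
    by exists (N z A' B); apply: rot_l.
  by case: (A) => // a A1 A2 [->]; exists (N z A1 (N i A2 B)); apply: rot_out.
case: (eqVneq (troot B) (Some i)) => [|/(IHB iN)[B' ?]]; last first.
  by exists (N z A B'); apply: rot_r.
by case: (B) => // a B1 B2 [->]; exists (N z (N i A B1) B2); apply: rot_in.
Qed.

Lemma rot_nonroot i t t' : rot i t t' -> uniq (lab t) -> troot t != Some i.
Proof.
case=> [z A B C|z A B C|z A A' B /rot_mem iA|z A B B' /rot_mem iB] /= /andP[];
by move=> + _; apply: contraNneq => -[->];
  rewrite ?(inE, mem_cat) ?iA ?iB ?eqxx ?orbT.
Qed.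

Lemma tri_notin a b c i : a != Some i -> b != Some i -> c != Some i ->
  forall x, tri a b c x i = 0 /\ tri a b c i x = 0.
Proof.
by move=> /negbTE ai /negbTE bi /negbTE ci x; rewrite /tri /link ai bi ci !andbF.
Qed.

(** The moving vertex meets only its parent's block and its own, so [mutates_tri] applies to these
    two; distinct labels keep every other block away from [i]. *)
Lemma rot_mutates i t t' :
  rot i t t' -> uniq (lab t) -> mutates (tarr t) (tarr t') i.
Proof.
have nr A : i \notin lab A -> troot A != Some i by move/root_notin=> ->.
elim=> {t t'} [z A B C|z A B C|z A A' B rA IH|z A B B' rB IH].
- rewrite (@perm_uniq _ _ (i :: z :: lab A ++ lab B ++ lab C)); last first.
    by apply/permP=> P; rewrite /= !count_cat /= ?count_cat; lia.
  rewrite /= inE !mem_cat !negb_or eq_sym => /andP[/and4P[zi iA iB iC] _].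
  apply: (@mutates_tri _ i (troot A) (troot B) (troot C) (Some z) _ _
    (fun x y => tarr A x y + tarr B x y + tarr C x y)); rewrite ?nr //.
  + by move=> x; rewrite !tarr_notin ?iA ?iB ?iC ?orbT.
  + by move=> x y /=; rewrite (tri_rot (Some z)); lia.
  + by move=> x y /=; rewrite (tri_rot (Some i) (Some z))
       (tri_rot (Some z) (troot A)); lia.
- rewrite (@perm_uniq _ _ (i :: z :: lab A ++ lab B ++ lab C)); last first.
    by apply/permP=> P; rewrite /= !count_cat /= ?count_cat; lia.
  rewrite /= inE !mem_cat !negb_or eq_sym => /andP[/and4P[zi iA iB iC] _].
  apply: (@mutates_tri _ i (Some z) (troot A) (troot B) (troot C) _ _
    (fun x y => tarr A x y + tarr B x y + tarr C x y)); rewrite ?nr //.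
  + by move=> x; rewrite !tarr_notin ?iA ?iB ?iC ?orbT.
  + by move=> x y /=; rewrite (tri_rot (Some i) (Some z))
       (tri_rot (Some z) (troot A)); lia.
  + by move=> x y /=; rewrite (tri_rot (Some z)); lia.
- have iA := rot_mem rA.
  rewrite /= mem_cat cat_uniq => /andP[/norP[zA zB] /and3P[uA dAB uB]].
  have iB : i \notin lab B by apply: contra dAB => iB; apply/hasP; exists i.
  have zi : Some z != Some i by apply: contraNneq zA => -[->].
  apply: (@mutatesD _ i _ _ _ _ (fun x y =>
    tri (Some z) (troot A) (troot B) x y + tarr B x y)) (IH uA) _ _ _.
  + move=> x; have [-> ->] := tri_notin zi (rot_nonroot rA uA) (nr _ iB) x.
    by rewrite !tarr_notin ?iB ?orbT.
  + by move=> x y /=; lia.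
  + by move=> x y /=; rewrite (rot_root rA); lia.
- have iB := rot_mem rB.
  rewrite /= mem_cat cat_uniq => /andP[/norP[zA zB] /and3P[uA dAB uB]].
  have iA : i \notin lab A by apply: contra dAB => iA; apply/hasP; exists i.
  have zi : Some z != Some i by apply: contraNneq zB => -[->].
  apply: (@mutatesD _ i _ _ _ _ (fun x y =>
    tri (Some z) (troot A) (troot B) x y + tarr A x y)) (IH uB) _ _ _.
  + move=> x; have [-> ->] := tri_notin zi (nr _ iA) (rot_nonroot rB uB) x.
    by rewrite !tarr_notin ?iA ?orbT.
  + by move=> x y /=; lia.
  + by move=> x y /=; rewrite (rot_root rB); lia.
Qed.

Inductive rots : seq L -> btree L -> btree L -> Prop :=
| rots_nil t : rots [::] t t
| rots_cons i s t t' t'' : rot i t t' -> rots s t' t'' -> rots (i :: s) t t''.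

Lemma rots_lab s t t' : rots s t t' -> perm_eq (lab t') (lab t).
Proof.
elim=> {s t t'} // i s t t' t'' /rot_lab r _ IH.
exact: perm_trans IH r.
Qed.

Lemma rots_root s t t' : rots s t t' -> troot t' = troot t.
Proof. by elim=> {s t t'} // i s t t' t'' /rot_root <-. Qed.

Lemma rots_cat s1 s2 t1 t2 t3 : rots s1 t1 t2 -> rots s2 t2 t3 -> rots (s1 ++ s2) t1 t3.
Proof. by elim=> {s1 t1 t2} //= i s t t' t'' r _ IH /IH; apply: rots_cons r. Qed.

Lemma rots_sym s t t' : rots s t t' -> rots (rev s) t' t.
Proof.
elim=> {s t t'} [t|i s t t' t'' r _ IH]; first exact: rots_nil.
rewrite rev_cons -cats1; apply: rots_cat IH _.
apply: rots_cons (rots_nil _); exact: rot_sym.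
Qed.

Lemma rots_exists s t :
  (forall i, i \in s -> i \in lab t /\ troot t != Some i) -> exists t', rots s t t'.
Proof.
elim: s t => [|i s IH] t st; first by exists t; apply: rots_nil.
have [it rt] := st i (mem_head _ _); have [t1 r] := rot_exists it rt.
have [|t2 r2] := IH t1; last by exists t2; apply: rots_cons r r2.
move=> j js; have := st j; rewrite inE js orbT => /(_ isT).
by rewrite (perm_mem (rot_lab r)) (rot_root r).
Qed.

Lemma rots_l z s A A' B : rots s A A' -> rots s (N z A B) (N z A' B).
Proof.
elim=> {s A A'} [t|i s t t' t'' r _ IH]; first exact: rots_nil.
exact: rots_cons (rot_l z B r) IH.
Qed.

(** The path with all arrows pointing along [p]: a left child is the target of an arrow from its
    parent. *)
Fixpoint comb (p : seq L) : btree L := if p is x :: p' then N x (comb p') E else E.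

Lemma lab_comb p : lab (comb p) = p.
Proof. by elim: p => //= x p ->; rewrite cats0. Qed.

(** Rotating at the root of the right subtree pushes it into the left one, which shrinks the right
    subtree at constant total size. Once the right subtree is empty, the left one is a smaller
    tree. *)
Lemma rots_comb t : exists s p, rots s t (comb p).
Proof.
have [n] := ubnP (size (lab t)); elim: n t => // n IHn [|z A B] /=.
  by exists [::], [::]; apply: rots_nil.
have [m] := ubnP (size (lab B)); elim: m B A => // m IHm [|b B1 B2] A.
  rewrite cats0 ltnS => _ /IHn[s [p r]]; exists s, (z :: p); exact: rots_l.
rewrite /= !size_cat /= size_cat !ltnS => lt_m lt_n.
have [||s [p r]] := IHm B2 (N b A B1).
- by lia.
- by rewrite /= !size_cat; lia.
by exists (b :: s), p; apply: rots_cons r; apply: rot_in.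
Qed.

End Trees.
Lemma rots_mutation (L : eqType) (T : finType) (h : T -> L) (Q : quiver T) s t t' :
  injective h -> uniq (lab t) -> (forall x y, arr Q x y = tarr t (h x) (h y)) ->
  rots (map h s) t t' ->
  forall x y, arr (foldl (@mutation T) Q s) x y = tarr t' (h x) (h y).
Proof.
move=> h_inj ut QE; move Eu: (map h s) => u r.
elim: r s Eu Q ut QE => {u t t'} [t|i u t t' t'' r _ IH] [|j s] //= [ij su] Q ut QE.
apply: IH => //; first by rewrite (perm_uniq (rot_lab r)).
rewrite -ij in r; apply: (mutation_mutates h_inj QE (rot_mutates r ut)).
by apply: tarr_no2cycle; rewrite (perm_uniq (rot_lab r)).
Qed.

Fixpoint tmap (L L' : Type) (f : L -> L') (t : btree L) : btree L' :=
  if t is N z A B then N (f z) (tmap f A) (tmap f B) else E.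

Section TreeMap.

Variables (L L' : eqType) (f : L -> L').

Lemma lab_tmap t : lab (tmap f t) = map f (lab t).
Proof. by elim: t => //= z A -> B ->; rewrite map_cat. Qed.

Lemma troot_tmap t : troot (tmap f t) = omap f (troot t).
Proof. by case: t. Qed.

Lemma tarr_tmap t x y :
  injective f -> tarr (tmap f t) (f x) (f y) = tarr t x y.
Proof.
move=> f_inj; have omapE o z : (omap f o == Some (f z)) = (o == Some z).
  by case: o => //= o; rewrite !(inj_eq Some_inj) (inj_eq f_inj).
elim: t => //= z A -> B ->; rewrite !troot_tmap.
by rewrite /tri /link !omapE -(omapE (Some z)) -(omapE (Some z)).
Qed.

Lemma tmap_lift t :
  (forall x, x \in lab t -> exists y, x = f y) -> exists t', tmap f t' = t.
Proof.
elim: t => [|z A IHA B IHB] /= lift; first by exists E.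
have [A' <-] : exists A', tmap f A' = A.
  by apply: IHA => x xA; apply: lift; rewrite inE mem_cat xA orbT.
have [B' <-] : exists B', tmap f B' = B.
  by apply: IHB => x xB; apply: lift; rewrite inE mem_cat xB !orbT.
by have [z' ->] := lift z (mem_head _ _); exists (N z' A' B').
Qed.

End TreeMap.

(** * Quivers of type A as unrooted trees of blocks, and rooted ones as trees *)

Section Block.

Variable L : eqType.
Implicit Types (X Y Z : btree L) (x y z : L).

(** A tree of blocks seen from one of its blocks rather than from a vertex: a quiver of type A has
    no distinguished root. *)
Definition block X Y Z x y : nat :=
  tri (troot X) (troot Y) (troot Z) x y + (tarr X x y + tarr Y x y + tarr Z x y).

Lemma block_rot X Y Z x y : block X Y Z x y = block Y Z X x y.
Proof. by rewrite /block tri_rot; lia. Qed.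

Lemma tri_leaf (a : option L) x y : tri a None None x y = 0.
Proof. by rewrite /tri /link /= andbF. Qed.

Lemma block_leaf z P Q : block (N z P Q) E E =2 tarr (N z P Q).
Proof. by move=> x y; rewrite /block tri_leaf /= !addn0. Qed.

Lemma block_root z P Q : block (N z E E) P Q =2 tarr (N z P Q).
Proof. by move=> x y; rewrite /block /= tri_leaf. Qed.

(** Moving to a child of the central block: a vertex lies in at most two
    blocks, and either of them may be taken as the central one. *)
Lemma block_center X Y Z z : z \in lab X -> exists P Q Y' Z',
  perm_eq (lab (N z P Q) ++ lab Y' ++ lab Z') (lab X ++ lab Y ++ lab Z) /\
  block (N z P Q) Y' Z' =2 block X Y Z.
Proof.
elim: X Y Z => //= v A IHA B IHB Y Z.
rewrite inE mem_cat => /or3P[/eqP->|/(IHA B (N v Y Z))|/(IHB (N v Y Z) A)].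
- by exists A, B, Y, Z.
- move=> [P [Q [Y' [Z' [/permP pE bE]]]]]; exists P, Q, Y', Z'; split.
    apply/permP=> a; have := pE a; rewrite /= !count_cat /= !count_cat; lia.
  by move=> x y; rewrite bE /block /= (tri_rot (troot A)) (tri_rot (troot B)); lia.
- move=> [P [Q [Y' [Z' [/permP pE bE]]]]]; exists P, Q, Y', Z'; split.
    apply/permP=> a; have := pE a; rewrite /= !count_cat /= !count_cat; lia.
  by move=> x y; rewrite bE /block /= (tri_rot (troot B)); lia.
Qed.

Lemma block_center_mem X Y Z z : z \in lab X ++ lab Y ++ lab Z ->
  exists P Q Y' Z',
  perm_eq (lab (N z P Q) ++ lab Y' ++ lab Z') (lab X ++ lab Y ++ lab Z) /\
  block (N z P Q) Y' Z' =2 block X Y Z.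
Proof.
rewrite !mem_cat => /or3P[] zX; first exact: block_center.
- have [P [Q [Y' [Z' [pE bE]]]]] := block_center Z X zX.
  exists P, Q, Y', Z'; split; first by rewrite (perm_trans pE) // catA perm_catC.
  by move=> x y; rewrite bE -block_rot.
- have [P [Q [Y' [Z' [pE bE]]]]] := block_center X Y zX.
  exists P, Q, Y', Z'; split; first by rewrite (perm_trans pE) // perm_catC catA.
  by move=> x y; rewrite bE block_rot.
Qed.

End Block.

(** Each vertex has the next one as its only child, on the left if the arrow leaves it and on the
    right if the arrow enters it. *)
Lemma dynkin_tree k (R : quiver 'I_k) p m l :
  dynkinA_orientation R -> map val p = iota m l ->
  exists t, [/\ lab t = p, troot t = ohead p &
                {in p &, forall x y, tarr t x y = arr R x y}].
Proof.
move=> dR; elim: p m l => [|x0 p IH] m l; first by exists E.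
case: l => //= l [x0m pE]; have [t [lab_t root_t tE]] := IH _ _ pE.
have p_gt x : x \in p -> m < x.
  by move/(map_f val); rewrite pE mem_iota => /andP[].
have x0p : x0 \notin p by apply/negP => /p_gt; rewrite -x0m ltnn.
have p1 x : x \in p -> (ohead p == Some x) = (x == m.+1 :> nat).
  case: p pE p_gt {IH tE lab_t root_t x0p} => // x1 p.
  case: l => //= l [x1m _] _ _.
  by rewrite (inj_eq Some_inj) eq_sym -val_eqE /= x1m.
have R0 x : x \in p -> nedges R x0 x = (ohead p == Some x).
  move=> xp; rewrite dR p1 // [X in X == _ :> nat]/= eq_sym.
  have := p_gt x xp; move: x0m; rewrite /=; case: eqP; case: eqP; lia.
have x0N x : x \in p -> (Some x0 == Some x) = false.
  by move=> xp; apply/negbTE; apply: contraNneq x0p => -[->].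
have r0 : (ohead p == Some x0) = false.
  by apply: contraNF x0p; case: (p) => //= a q /eqP[->]; rewrite mem_head.
have tN x : (tarr t x0 x = 0) * (tarr t x x0 = 0).
  by rewrite !tarr_notin ?lab_t ?x0p ?orbT.
(* If no arrow leaves [x0], the rest of the path hangs on the right; otherwise it hangs on the
   left. *)
have [z0|z0] := posnP (\sum_(x <- p) arr R x0 x).
  have z x : x \in p -> arr R x0 x = 0.
    by move=> xp; apply/eqP; move/eqP: z0; rewrite sum_nat_seq_eq0 => /allP/(_ x xp).
  exists (N x0 E t); rewrite /= lab_t; split=> // x y.
  rewrite !inE /tri /link root_t => /orP[/eqP->|xp] /orP[/eqP->|yp];
    rewrite ?r0 ?tN ?eqxx ?x0N ?andbF ?arr_loopless //=.
  + by rewrite z.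
  + by have := R0 x xp; rewrite /nedges z //; case: (_ == _) => /=; lia.
  + by rewrite tE //; lia.
have [x1 x1p x1z] : exists2 x1, x1 \in p & 0 < arr R x0 x1.
  move: z0; rewrite lt0n sum_nat_seq_neq0 => /hasP[x1 /= ? ?].
  by exists x1; rewrite // lt0n.
have x1E : ohead p = Some x1.
  by apply/eqP; have := R0 x1 x1p; rewrite /nedges; case: (_ == _) => //=; lia.
have z x : x \in p -> arr R x x0 = 0.
  move=> xp; have := R0 x xp; rewrite /nedges x1E; case: eqP => [[<-]|_]; last by lia.
  by move=> _; apply: arr_no2cycle.
exists (N x0 t E); rewrite /= lab_t cats0; split=> // x y.
rewrite !inE /tri /link root_t => /orP[/eqP->|xp] /orP[/eqP->|yp];
  rewrite ?r0 ?tN ?eqxx ?x0N ?andbF ?arr_loopless //=.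
+ by have := R0 y yp; rewrite /nedges z //; case: (_ == _) => /=; lia.
+ by rewrite z.
+ by rewrite tE //; lia.
Qed.

(** A phantom root [None] is attached to one end of the Dynkin diagram: it is
    never mutated, so that all the mutations become rotations. *)
Lemma typeA_block k (T : finType) (Q : quiver T) : typeA k Q ->
  exists A B : btree T, [/\ uniq (lab A ++ lab B),
    forall x, x \in lab A ++ lab B & arr Q =2 block A B E].
Proof.
move=> [R [dR [s [g [g_bij gE]]]]].
have g_inj := bij_inj g_bij; pose h i := Some (g i).
have h_inj : injective h by move=> i j [/g_inj].
have [|t0 [lab0 root0 t0E]] := @dynkin_tree k R (enum 'I_k) 0 k dR.
  exact: val_enum_ord.
pose t1 := N None (tmap h t0) E.
have lab1 : lab t1 = None :: map h (enum 'I_k).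
  by rewrite /= cats0 lab_tmap lab0.
have u1 : uniq (lab t1).
  rewrite lab1 /= (map_inj_uniq h_inj) enum_uniq andbT.
  by apply/negP=> /mapP[].
have RE x y : arr R x y = tarr t1 (h x) (h y).
  have NE z : (Some None == Some (h z)) = false by [].
  by rewrite /= tarr_tmap // t0E ?mem_enum // /tri /link !NE !andbF !addn0.
have [t2 r] : exists t2, rots (map h s) t1 t2.
  apply: rots_exists => _ /mapP[i _ ->]; split=> //.
  by rewrite lab1 inE map_f ?mem_enum ?orbT.
have QE := rots_mutation h_inj u1 RE r.
have := rots_lab r; rewrite lab1 => /perm_mem lab2.
have u2 : uniq (lab t2) by rewrite (perm_uniq (rots_lab r)).
have := rots_root r; case: t2 => [|v A' B'] //= in lab2 u2 QE {r} * => -[vN].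
rewrite vN in lab2 u2 QE.
(* The label [None] sits at the root and labels are distinct, so both subtrees have labels of the
   form [Some x] and come from trees on [T]. *)
have lift t : {subset lab t <= lab A' ++ lab B'} -> exists t', tmap Some t' = t.
  move=> tAB; apply: tmap_lift => -[x _|/tAB]; first by exists x.
  by move/andP: u2 => [/negbTE->].
have [A AE] : exists A, tmap Some A = A'.
  by apply: lift => x xA; rewrite mem_cat xA.
have [B BE] : exists B, tmap Some B = B'.
  by apply: lift => x xB; rewrite mem_cat xB orbT.
have sI : injective (@Some T) by move=> ? ? [].
exists A, B; split.
- by case/andP: u2 => _; rewrite -AE -BE !lab_tmap -map_cat (map_inj_uniq sI).
- move=> x; have := lab2 (Some x); rewrite -AE -BE !lab_tmap -map_cat.
  rewrite !inE /= (mem_map sI) => ->; apply/mapP; case: g_bij => g' _ g'K.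
  by exists (g' x); rewrite ?mem_enum // /h g'K.
- move=> x y; case: g_bij => g' _ g'K; rewrite -(g'K x) -(g'K y) gE QE.
  rewrite -AE -BE !troot_tmap !tarr_tmap // /block addn0; congr (_ + _).
  have omapE o z : (omap Some o == Some (Some z)) = (o == Some z :> option T) by case: o.
  by rewrite /tri /link !omapE /= ?andbF ?addn0 ?add0n.
Qed.

Definition tree_quiver (T : finType) (Q : quiver T) (t : btree T) z :=
  [/\ uniq (lab t), forall x, x \in lab t, troot t = Some z
    & arr Q =2 tarr t].

Lemma sum_troot (T : finType) (t : btree T) :
  \sum_(y : T) (troot t == Some y) = (troot t != None).
Proof.
case: (troot t) => [z|] /=; last by rewrite big1.
rewrite (bigD1 z) //= eqxx big1 // => y /negbTE yz.
by rewrite (inj_eq Some_inj) eq_sym yz.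
Qed.

Lemma uniq_cat_notin (S : eqType) (s1 s2 : seq S) x :
  uniq (s1 ++ s2) -> x \in s1 -> x \notin s2.
Proof.
by rewrite cat_uniq => /and3P[_ /hasPn d _] xs1; apply: contraL xs1 => /d.
Qed.

Lemma troot_None (S : eqType) (t : btree S) : troot t = None -> t = E.
Proof. by case: t. Qed.

Lemma tarr_from_root (S : eqType) z (A B : btree S) y :
  uniq (lab (N z A B)) -> tarr (N z A B) z y = (troot A == Some y).
Proof.
rewrite /= mem_cat => /andP[/norP[zA zB] _].
rewrite !(@tarr_notin _ _ z) ?zA ?zB //.
by rewrite /tri /link eqxx (root_notin zA) (root_notin zB) !addn0.
Qed.

Lemma tarr_to_root (S : eqType) z (A B : btree S) y :
  uniq (lab (N z A B)) -> tarr (N z A B) y z = (troot B == Some y).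
Proof.
rewrite /= mem_cat => /andP[/norP[zA zB] _].
rewrite !(@tarr_notin _ _ y z) ?zA ?zB ?orbT //.
by rewrite /tri /link eqxx (root_notin zA) (root_notin zB) !andbF andbT !addn0.
Qed.

(** Recentred at [z], the quiver has the blocks [(z, P, P')] and [(z, R, R')], with no arrows
    between the two sides. If both are non-trivial, the valency bound leaves one neighbour on each
    side, and the required 3-cycle through [z] would need an arrow across. So one block is trivial
    and [z] is a root. *)
Lemma rooted_typeA_tree (T : finType) (Q : quiver T) z :
  rooted_typeA Q z -> exists t, tree_quiver Q t z.
Proof.
move=> [[k _ /typeA_block[A0 [B0 [u0 all0 QE0]]]] val2 val3].
have [|P [P' [R [R' [pE bE]]]]] := @block_center_mem _ A0 B0 E z.
  by rewrite cats0.
have {}QE x y : arr Q x y = block (N z P P') R R' x y by rewrite bE.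
have all_lab x : x \in lab (N z P P') ++ lab R ++ lab R'.
  by rewrite (perm_mem pE) cats0.
have ul : uniq (lab (N z P P') ++ lab R ++ lab R') by rewrite (perm_uniq pE) cats0.
clear A0 B0 u0 all0 QE0 pE bE.
have uP : uniq (lab (N z P P')) by move: ul; rewrite cat_uniq => /andP[].
have uR : uniq (lab (N z R R')).
  have zR := uniq_cat_notin ul (mem_head z _).
  by move: ul; rewrite /= zR cat_uniq => /andP[_ /and3P[]].
have zE y : arr Q z y = (troot P == Some y) + (troot R == Some y).
  by rewrite -(tarr_from_root y uP) -(tarr_from_root y uR) QE /block /=; lia.
have zE' y : arr Q y z = (troot P' == Some y) + (troot R' == Some y).
  by rewrite -(tarr_to_root y uP) -(tarr_to_root y uR) QE /block /=; lia.
have valE : valency Q z = (troot P != None) + (troot P' != None) +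
    ((troot R != None) + (troot R' != None)).
  rewrite -!sum_troot -!big_split; apply: eq_bigr => y _ /=.
  by rewrite /nedges zE zE'; lia.
have [/andP[/eqP/troot_None R0 /eqP/troot_None R'0]|RN] :=
    boolP ((troot R == None) && (troot R' == None)).
  exists (N z P P'); split=> // [x|x y].
    by have := all_lab x; rewrite R0 R'0 /= !cats0.
  by rewrite QE R0 R'0 block_leaf.
have [/andP[/eqP/troot_None P0 /eqP/troot_None P'0]|PN] :=
    boolP ((troot P == None) && (troot P' == None)).
  exists (N z R R'); split=> // [x|x y].
    by have := all_lab x; rewrite P0 P'0 /=.
  by rewrite QE P0 P'0 block_root.
(* Both blocks at [z] are non-trivial here, so its valency is exactly two and the 3-cycle must
   exist. *)
case: val3.
  by move: val2; rewrite valE; move: RN PN; do 4 case: (_ == None) => //=.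
have uRR : uniq (lab R ++ lab R') by case/andP: uR.
have uPP : uniq (lab P ++ lab P') by case/andP: uP.
have tN (t : btree T) u v : v \notin lab t -> tarr t u v = 0.
  by move=> H; rewrite tarr_notin // H orbT.
move=> u [v []]; rewrite zE zE' => zu uv vz; exfalso.
have [rPu|rPu] := eqVneq (troot P) (Some u);
  have [rPv|rPv] := eqVneq (troot P') (Some v).
- move: val2 RN; rewrite valE rPu rPv /=; do 2 case: (_ == None) => //=.
- have rRv : troot R' = Some v.
    by apply/eqP; move: vz; rewrite (negbTE rPv); case: (_ == _).
  have [uP1 vR] := (root_lab rPu, root_lab rRv).
  have := uniq_cat_notin ul (x := u); rewrite /= inE mem_cat uP1 orbT mem_cat.
  case/(_ isT)/norP=> uR1 uR2.
  have uz : (Some z == Some u) = false.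
    by apply: contraTF uP1 => /eqP[<-]; case/andP: uP; rewrite mem_cat => /norP[].
  have vP : v \notin lab (N z P P').
    by apply: contraTN vR => /(uniq_cat_notin ul); rewrite mem_cat => /norP[].
  have vR1 : v \notin lab R by apply: contraTN vR => /(uniq_cat_notin uRR).
  move: uv; rewrite QE /block (tN _ _ _ vP) (tN _ _ _ vR1).
  by rewrite tarr_notin ?uR2 // /tri /link uz (root_notin uR1) (root_notin uR2).
- have rRu : troot R = Some u.
    by apply/eqP; move: zu; rewrite (negbTE rPu); case: (_ == _).
  have [uR1 vP1] := (root_lab rRu, root_lab rPv).
  have := uniq_cat_notin ul (x := v); rewrite /= inE mem_cat vP1 !orbT mem_cat.
  case/(_ isT)/norP=> vR1 vR2.
  have vz' : (Some z == Some v) = false.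
    by apply: contraTF vP1 => /eqP[<-]; case/andP: uP; rewrite mem_cat => /norP[].
  have uP1 : u \notin lab (N z P P').
    by apply: contraTN uR1 => /(uniq_cat_notin ul); rewrite mem_cat => /norP[].
  move: uv; rewrite QE /block (tN _ _ _ vR1) (tN _ _ _ vR2).
  by rewrite tarr_notin ?uP1 // /tri /link vz' !(root_notin vR1) !(root_notin vR2) !andbF.
- move: zu vz; rewrite (negbTE rPu) (negbTE rPv) /=.
  case: eqP => // rRu _; case: eqP => // rRv _.
  by move: val2 PN; rewrite valE rRu rRv /=; do 2 case: (_ == None).
Qed.

Lemma tarr_comb (S : eqType) (x0 : S) (p : seq S) i j :
  uniq p -> i < size p -> j < size p ->
  tarr (comb p) (nth x0 p i) (nth x0 p j) = (i.+1 == j).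
Proof.
elim: p i j => //= x p IH i j /andP[xp up] i_lt j_lt.
have r v : (troot (comb p) == Some v) = (ohead p == Some v) by case: (p).
have xN v : v \in p -> (Some x == Some v) = false.
  by move=> vp; apply: contraNF xp => /eqP[->].
have tN v w : (v == x) || (w == x) -> tarr (comb p) v w = 0.
  by move=> vw; rewrite tarr_notin // lab_comb; case/orP: vw => /eqP->; rewrite xp ?orbT.
rewrite /tri /link !r.
have hE k : k < size p -> (ohead p == Some (nth x0 p k)) = (k == 0).
  case: (p) up => //= y q /andP[yq _]; case: k => [|k] /=; first by rewrite eqxx.
  by rewrite ltnS => kq; apply: contraNF yq => /eqP[->]; rewrite mem_nth.
have hx : (ohead p == Some x) = false.
  by apply: contraNF xp; case: (p) => //= a q /eqP[->]; rewrite mem_head.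
case: i j i_lt j_lt => [|i] [|j] /=; rewrite ?ltnS => i_lt j_lt.
- by rewrite hx tN ?eqxx // !andbF.
- by rewrite tN ?eqxx // hE //= !andbF; lia.
- by rewrite tN ?eqxx ?orbT // hx !andbF.
- by rewrite IH // xN ?mem_nth // hE // !andbF; lia.
Qed.

(** Rotations are mutations, so the reversed sequence of rotations leading to the comb builds the
    tree from the linearly oriented diagram. *)
Lemma tree_rooted_typeA (T : finType) (Q : quiver T) t z :
  tree_quiver Q t z -> rooted_typeA Q z.
Proof.
move=> [ut all_t]; case: t ut all_t => // z' A B ut all_t [zz'] QE; subst z'.
have valE : valency Q z = (troot A != None) + (troot B != None).
  rewrite -!sum_troot -big_split; apply: eq_bigr => y _.
  by rewrite /nedges !QE tarr_from_root // tarr_to_root.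
split; last 2 first.
- by rewrite valE; do 2 case: (_ == None).
- rewrite valE; case rA: (troot A) => [u|]; case rB: (troot B) => [v|] //= _.
  exists u, v; rewrite !QE tarr_from_root // tarr_to_root // rA rB !eqxx /=.
  by rewrite rA rB /tri /link !eqxx; split=> //; lia.
have [s [p r]] := rots_comb (N z A B).
have pE : p =i lab (N z A B) by move=> x; rewrite -(perm_mem (rots_lab r)) lab_comb.
have up : uniq p by rewrite -(lab_comb p) (perm_uniq (rots_lab r)).
have p_gt0 : 0 < size p by case: (p) (pE z) => //; rewrite all_t.
exists (size p) => //.
pose arrR (i j : 'I_(size p)) : nat := i.+1 == j.
have R0 i : arrR i i = 0 by rewrite /arrR; lia.
have R2 i j : 0 < arrR i j -> arrR j i = 0 by rewrite /arrR; lia.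
exists (Quiver R0 R2); split=> //.
set R := Quiver _ _; pose h (i : 'I_(size p)) := nth z p i.
have h_inj : injective h.
  by move=> i j /eqP; rewrite nth_uniq ?ltn_ord // => /eqP/val_inj.
have p_all x : index x p < size p by rewrite index_mem pE all_t.
pose g x := Ordinal (p_all x).
have gK x : h (g x) = x by apply: nth_index; rewrite pE all_t.
have RE i j : arr R i j = tarr (comb p) (h i) (h j) by rewrite tarr_comb.
exists (map g (rev s)), h; split.
  by exists g => // i; apply: h_inj; rewrite gK.
move=> x y; rewrite QE; symmetry; apply: rots_mutation => //.
  by rewrite lab_comb.
by rewrite -map_comp (@eq_map _ _ _ id) ?map_id //; apply: rots_sym.
Qed.

(** A segment [(c, d, t)] of a cyclic list: a vertex [c] of the non-oriented
    cycle, the direction [d] of the arrow [alpha] joining it to the next one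
    ([true] if it starts at [c]), and the quiver [Q_alpha] as a tree [t] rooted
    at [z_alpha], empty if there is no 3-cycle on [alpha]. *)
Definition segment (L : Type) := (L * bool * btree L)%type.

(** * Cyclic lists of segments and their behaviour under mutation *)

Section Circuits.

Variable L : eqType.
Implicit Types (x y c u v i : L) (s : segment L) (w : seq (segment L)).
Implicit Types (t : btree L) (d : bool).

Definition seg u v d t x y : nat :=
  (if d then tri (Some u) (Some v) (troot t) x y
   else tri (Some v) (Some u) (troot t) x y) + tarr t x y.

Definition start w c : L := if w is s :: _ then s.1.1 else c.

(** The vertex [c] is where the last segment ends. Leaving it free makes arrow counts additive under
    concatenation; [circ] closes the list up. *)
Fixpoint chain w c x y : nat :=
  if w is s :: w' then seg s.1.1 (start w' c) s.1.2 s.2 x y + chain w' c x y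
  else 0.

Definition circ w x y : nat := if w is s :: _ then chain w s.1.1 x y else 0.

Definition wlab w : seq L := flatten [seq s.1.1 :: lab s.2 | s : segment L <- w].

(** The two directions express that the cycle is not oriented; they also force at least two
    segments, which excludes a loop. *)
Definition annular w :=
  [&& uniq (wlab w), has (fun s => s.1.2) w & has (fun s => ~~ s.1.2) w].

Lemma wlab_cat w1 w2 : wlab (w1 ++ w2) = wlab w1 ++ wlab w2.
Proof. by rewrite /wlab map_cat flatten_cat. Qed.

Lemma start_wlab w c : start w c \in c :: wlab w.
Proof. by case: w => [|s w]; rewrite !inE eqxx ?orbT. Qed.

Lemma chain_cat w1 w2 c x y :
  chain (w1 ++ w2) c x y = chain w1 (start w2 c) x y + chain w2 c x y.
Proof.
elim: w1 => //= s w1 ->; rewrite addnA.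
by congr (seg _ _ _ _ _ _ + _ + _); case: (w1).
Qed.

Lemma circ_catC w1 w2 : circ (w1 ++ w2) =2 circ (w2 ++ w1).
Proof.
case: w1 w2 => [|s1 w1] [|s2 w2] x y //; rewrite ?cats0 //.
by rewrite /circ !cat_cons -!cat_cons !chain_cat addnC.
Qed.

Lemma annular_catC w1 w2 : annular (w1 ++ w2) = annular (w2 ++ w1).
Proof.
by rewrite /annular !wlab_cat uniq_catC !has_cat orbC (orbC (has _ w1) (has _ w2)).
Qed.

Lemma seg_notin u v d t x : x != u -> x != v -> x \notin lab t ->
  forall y, seg u v d t x y = 0 /\ seg u v d t y x = 0.
Proof.
move=> xu xv xt y; rewrite /seg !tarr_notin ?xt ?orbT //.
have ux : Some u != Some x by rewrite (inj_eq Some_inj) eq_sym.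
have vx : Some v != Some x by rewrite (inj_eq Some_inj) eq_sym.
have tx : troot t != Some x by rewrite root_notin.
by case: d; [have [-> ->] := tri_notin ux vx tx y|have [-> ->] := tri_notin vx ux tx y].
Qed.

Lemma chain_notin w c x : x != c -> x \notin wlab w ->
  forall y, chain w c x y = 0 /\ chain w c y x = 0.
Proof.
move=> xc + y; elim: w => //= s w IH.
rewrite /wlab /= inE mem_cat !negb_or -/(wlab w) => /and3P[xs xt /[dup] xw /IH].
have xn : x != start w c.
  by apply: contraTneq (start_wlab w c) => <-; rewrite inE negb_or xc.
by have [-> ->] := seg_notin s.1.2 xs xn xt y; move=> [-> ->].
Qed.

Lemma seg_no2cycle u v d t : uniq (u :: v :: lab t) -> no2cycle (seg u v d t).
Proof.
move=> ut.
have E1 x y : seg u v true t x y = tarr (N u (N v E E) t) x y.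
  by rewrite /seg /= tri_leaf.
have E2 x y : seg u v false t x y = tarr (N v (N u E E) t) x y.
  by rewrite /seg /= tri_leaf.
move=> x y; case: d; rewrite ?E1 ?E2; apply: tarr_no2cycle => //.
by rewrite (@perm_uniq _ _ (u :: v :: lab t)) // (perm_catCA [:: v] [:: u]).
Qed.

Lemma chain_split w c x y : 0 < chain w c x y -> exists w1 s w2,
  w = w1 ++ s :: w2 /\ 0 < seg s.1.1 (start w2 c) s.1.2 s.2 x y.
Proof.
elim: w => //= s w IH; rewrite addn_gt0 => /orP[sxy|/IH[w1 [s' [w2 [-> ?]]]]].
  by exists [::], s, w.
by exists (s :: w1), s', w2.
Qed.

Lemma seg_ends u v d t : uniq (u :: v :: lab t) ->
  seg u v d t u v = d /\ seg u v d t v u = ~~ d.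
Proof.
rewrite /= inE negb_or => /and3P[/andP[uv ut] vt _].
have uvF : (Some u == Some v) = false by rewrite (inj_eq Some_inj); apply/negbTE.
have vuF : (Some v == Some u) = false by rewrite eq_sym.
rewrite /seg !tarr_notin ?ut ?vt // /tri /link !eqxx uvF vuF.
by rewrite (root_notin ut) (root_notin vt); case: d.
Qed.

Lemma circ_split w x y : 0 < circ w x y -> exists w1 s w2,
  w = w1 ++ s :: w2 /\ 0 < seg s.1.1 (start (w2 ++ w1) s.1.1) s.1.2 s.2 x y.
Proof.
case: w => // s0 w /chain_split[w1 [s [w2 [wE sxy]]]].
exists w1, s, w2; split=> //; case: w2 wE sxy => //=.
by case: w1 => [|s1 w1] [-> _].
Qed.

Lemma annular_size w : annular w -> 1 < size w.
Proof. by case: w => [|s [|s' w]] // /and3P[_] /=; case: s.1.2. Qed.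

Lemma annular_cons c d t w : annular ((c, d, t) :: w) ->
  [/\ 0 < size w, start w c != c & uniq (c :: start w c :: lab t)].
Proof.
case: w => [/annular_size //|[[c' d'] t'] w] /and3P[uw _ _].
rewrite /wlab /= in uw; move: uw; rewrite mem_cat inE !negb_or.
move=> /andP[/and3P[ct cc _] ul].
have c't : c' \notin lab t.
  by apply/negP => /(uniq_cat_notin ul); rewrite mem_head.
have ut : uniq (lab t) by move: ul; rewrite cat_uniq => /andP[].
split; [by [] | by rewrite /= eq_sym | rewrite cons_uniq cons_uniq inE negb_or].
by rewrite cc ct c't.
Qed.

(** A single segment is itself a tree, hence has no 2-cycle, and different segments share at most
    their ends. They share both ends only if there are exactly two segments; the list then goes from
    [c] to [c'] and back, so the opposite directions imposed by [annular] make the two arrows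
    parallel. *)
Lemma circ_no2cycle w : annular w -> no2cycle (circ w).
Proof.
move=> aw x y /circ_split[w1 [[[c d] t] [w2 [wE]]]] /=; move: aw.
rewrite {w}wE annular_catC circ_catC cat_cons.
move: {w1 w2}(w2 ++ w1) => w aw sxy; rewrite /=.
have [w0 nc ul] := annular_cons aw.
have sE z : z \in [:: x; y] -> z != c -> z != start w c -> z \in lab t.
  move=> zxy zc zn; apply: contraLR sxy => /(seg_notin d zc zn) z0.
  move: zxy z0; rewrite !inE => /orP[]/eqP-> z0; first by rewrite (z0 y).1.
  by rewrite (z0 x).2.
rewrite (seg_no2cycle (t := t) (d := d)) // add0n.
have uw : uniq (c :: lab t ++ wlab w) by case/and3P: aw.
have tw z : z \in lab t -> z != c /\ z \notin wlab w.
  move=> zt; move: uw => /=/andP[cN /uniq_cat_notin/(_ zt)->]; split=> //.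
  by apply: contraNneq cN => <-; rewrite mem_cat zt.
have cw : c \notin wlab w by move: uw; rewrite /= mem_cat negb_or => /andP[/andP[]].
have [xt|xt] := boolP (x \in lab t).
  by have [xc xw] := tw x xt; rewrite (chain_notin xc xw y).2.
have [yt|yt] := boolP (y \in lab t).
  by have [yc yw] := tw y yt; rewrite (chain_notin yc yw x).1.
have xE : (x == c) || (x == start w c).
  by apply: contraR xt => /norP[xc xn]; apply: sE; rewrite ?inE ?eqxx.
have yE : (y == c) || (y == start w c).
  by apply: contraR yt => /norP[yc yn]; apply: sE; rewrite ?inE ?eqxx ?orbT.
case: w w0 nc ul uw tw cw xE yE sxy aw {sE} => //= -[[c' d'] t'] w _ /= nc ul _ _ cw.
(* From here on [x] and [y] are the two ends [c] and [c'] of the chosen segment. *)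
have [ec ec'] := seg_ends d ul.
have c'c : uniq [:: c'; c] by rewrite /= inE nc.
move=> xE yE sxy aw; suff main : seg c' (start w c) d' t' y x = 0 /\ chain w c y x = 0.
  by rewrite !main.1 !main.2.
have xy : x != y.
  apply: contraTneq sxy => ->; case: posnP => // /[dup] yy.
  by move/(seg_no2cycle ul)=> y0; rewrite y0 in yy.
have cE : (y == c) || (x == c).
  by case/orP: xE xy => [->|/eqP->]; case/orP: yE => /eqP->; rewrite ?eqxx ?orbT.
case: w cw aw => [|s w] cw aw /=.
  have dd : d' = ~~ d by case/and3P: aw => _ /=; case: (d); case: (d').
  have /annular_cons[_ _ ul'] : annular [:: (c', d', t'); (c, d, t)].
    by rewrite (annular_catC [:: _] [:: _]).
  have [fc fc'] := seg_ends d' ul'.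
  split=> //=; case/orP: xE xy sxy => /eqP->; case/orP: yE => /eqP->;
    rewrite ?eqxx //= => _.
    by rewrite ec fc dd; case: (d).
  by rewrite ec' fc' dd; case: (d).
have c'w : c' != c /\ c' \notin wlab (s :: w).
  split=> //; have /and3P[uw _ _] : annular ((c', d', t') :: s :: w ++ [:: (c, d, t)]).
    by rewrite (annular_catC (_ :: _ :: _) [:: _]).
  move: uw; rewrite -!cat_cons wlab_cat cat_uniq => /andP[/= + _].
  by rewrite mem_cat negb_or => /andP[/andP[]].
have c'E : (y == c') || (x == c').
  by case/orP: xE xy => [/eqP->|->]; case/orP: yE => /eqP->; rewrite ?eqxx ?orbT.
split; last first.
  by case/orP: c'E => /eqP->; have [? ?] := chain_notin c'w.1 c'w.2 y;
     have [? ?] := chain_notin c'w.1 c'w.2 x.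
have cs : c != start (s :: w) c.
  by apply: contraNneq cw => -> /=; rewrite /wlab /= !inE mem_cat !inE eqxx !orbT.
have ct' : c \notin lab t'.
  by apply: contra cw => ct'; rewrite /wlab /= !inE mem_cat ct' orbT.
have cc' : c != c' by rewrite eq_sym.
have [cy yc] := seg_notin d' cc' cs ct' x; have [cx xc] := seg_notin d' cc' cs ct' y.
by case/orP: cE => /eqP->.
Qed.

End Circuits.

Definition circuit (T : finType) (Q : quiver T) (w : seq (segment T)) :=
  [/\ annular w, forall x, x \in wlab w & arr Q =2 circ w].

Lemma circuit_catC (T : finType) (Q : quiver T) w1 w2 :
  circuit Q (w1 ++ w2) -> circuit Q (w2 ++ w1).
Proof.
move=> [aw all_w QE]; split=> [|x|x y]; first by rewrite annular_catC.
  by have := all_w x; rewrite !wlab_cat !mem_cat orbC.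
by rewrite QE circ_catC.
Qed.

Lemma circuit_mutates (T : finType) (Q : quiver T) w w' i :
  circuit Q w -> perm_eq (wlab w') (wlab w) ->
  has (fun s => s.1.2) w' -> has (fun s => ~~ s.1.2) w' ->
  mutates (circ w) (circ w') i -> circuit (mutation Q i) w'.
Proof.
move=> [/and3P[uw _ _] all_w QE] pw w1 w2 mw.
have aw' : annular w' by rewrite /annular (perm_uniq pw) uw w1 w2.
split=> // [x|x y]; first by rewrite (perm_mem pw).
by apply: (mutation_mutates (h := id)) mw _ _ _ => //; apply: circ_no2cycle.
Qed.

Ltac addn_ac :=
  repeat match goal with
  | |- context [tri ?a ?b ?c ?x ?y] => move: (tri a b c x y) => ?
  | |- context [tarr ?t ?x ?y] => move: (tarr t x y) => ?
  | |- context [chain ?w ?c ?x ?y] => move: (chain w c x y) => ?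
  end; clear; lia.

(** Below the root of [t] this is a rotation inside [t]. The root lies in its own block and in that
    of the cycle arrow; the exchange inserts it into the cycle, replacing that arrow by two arrows
    of the same direction which carry its two subtrees. *)
Lemma circuit_mutation_tree (T : finType) (Q : quiver T) c d t w i :
  circuit Q ((c, d, t) :: w) -> i \in lab t ->
  exists w', circuit (mutation Q i) w'.
Proof.
move=> cw it; have [aw _ _] := cw; have [w0 nc /and3P[]] := annular_cons aw.
rewrite inE negb_or => /andP[cn ct] nt ut.
have ic : i != c by apply: contraNneq ct => <-.
have si : Some (start w c) != Some i by apply: contraNneq nt => -[->].
have ci : Some c != Some i by rewrite (inj_eq Some_inj) eq_sym.
have iw : i \notin wlab w.
  case/and3P: aw => /= /andP[_ /uniq_cat_notin] + _ _; exact.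
have [ri|] := eqVneq (troot t) (Some i); last first.
  move=> /(rot_exists it)[t' r]; exists ((c, d, t') :: w).
  apply: (circuit_mutates cw); try by case/and3P: aw.
    by rewrite /wlab /= perm_cons perm_cat2r (rot_lab r).
  apply: (@mutatesD _ i _ _ _ _ (fun x y => (if d then
      tri (Some c) (Some (start w c)) (troot t) x y
    else tri (Some (start w c)) (Some c) (troot t) x y) + chain w c x y))
    (rot_mutates r ut) _ _ _.
  - move=> x; have [-> ->] := chain_notin ic iw x; have ri := rot_nonroot r ut.
    by case: (d); [have [-> ->] := tri_notin ci si ri x|
                   have [-> ->] := tri_notin si ci ri x].
  - by move=> x y; rewrite [RHS]addnCA addnA.
  - by move=> x y; rewrite [RHS]addnCA addnA /= /seg (rot_root r).
case: t ri it ct nt ut cw aw {cn} => //= j A B [->] _ ct nt ut cw aw.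
have [iA iB] : i \notin lab A /\ i \notin lab B.
  by move: ut; rewrite mem_cat negb_or => /andP[/andP[]].
have nA : troot A != Some i by rewrite root_notin.
have nB : troot B != Some i by rewrite root_notin.
exists (if d then (c, true, B) :: (i, true, A) :: w
        else (c, false, A) :: (i, false, B) :: w).
apply: (circuit_mutates cw); try by case: (d) aw => /and3P[].
  apply/permP => P; rewrite /wlab.
  by case: (d); rewrite /= !count_cat /= ?count_cat; clear; lia.
pose R x y := tarr A x y + tarr B x y + chain w c x y.
have RN x : R x i = 0 /\ R i x = 0.
  by rewrite /R !tarr_notin ?iA ?iB ?orbT //; have [-> ->] := chain_notin ic iw x.
case: (d).
  apply: (@mutates_tri _ i _ _ _ _ _ _ R nA nB ci si) => // x y.
    by rewrite /= /seg /= (tri_rot (Some c)) (tri_rot _ (Some i)) /R; addn_ac.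
  by rewrite /= /seg /= (tri_rot (Some c)) /R; addn_ac.
apply: (@mutates_tri _ i _ _ _ _ _ _ R nA nB si ci) => // x y.
  by rewrite /= /seg /= (tri_rot _ _ (Some i)) (tri_rot _ (Some i)) /R; addn_ac.
by rewrite /= /seg /= (tri_rot _ (Some i)) /R; addn_ac.
Qed.

(** If the two cycle arrows at [i] form a path, the exchange takes [i] off the cycle and makes it
    the root of a tree on the new arrow between its neighbours, with [t] and [t0] as subtrees. If
    [i] is a source or a sink of the cycle, both arrows are reversed and the two trees trade
    places. *)
Lemma circuit_mutation_vertex (T : finType) (Q : quiver T) p d0 t0 i d t w :
  circuit Q ((p, d0, t0) :: (i, d, t) :: w) ->
  exists w', circuit (mutation Q i) w'.
Proof.
move=> cw; have [aw _ _] := cw; have [_ /= ip _] := annular_cons aw.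
have aw2 : annular ((i, d, t) :: w ++ [:: (p, d0, t0)]).
  by move: aw; rewrite -[_ :: _ :: _]/([:: _] ++ _) annular_catC.
have [_ ni /= /and3P[]] := annular_cons aw2.
rewrite inE negb_or => /andP[_ it] _ _.
have sE : start (w ++ [:: (p, d0, t0)]) i = start w p by case: (w).
rewrite sE in ni.
have [it0 iw] : i \notin lab t0 /\ i \notin wlab w.
  have /and3P[] := aw2; rewrite /wlab /= map_cat flatten_cat /= cats0 -/(wlab w).
  rewrite !mem_cat inE !negb_or.
  by move=> /andP[/andP[_ /and3P[]]].
have ri : troot t != Some i by rewrite root_notin.
have r0i : troot t0 != Some i by rewrite root_notin.
have pi : Some p != Some i by rewrite (inj_eq Some_inj) eq_sym.
(* This is the vertex following [i]. On a double arrow it is [p] itself, which the exchange of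
   blocks permits. *)
have qi : Some (start w p) != Some i by rewrite (inj_eq Some_inj).
have [wp wm] : has (fun s => s.1.2) ((p, d0, t0) :: (i, d, t) :: w) /\
    has (fun s => ~~ s.1.2) ((p, d0, t0) :: (i, d, t) :: w) by case/and3P: aw.
exists (match d0, d with
  | true, true => (p, true, N i t t0) :: w
  | false, false => (p, false, N i t0 t) :: w
  | true, false => (p, false, t) :: (i, true, t0) :: w
  | false, true => (p, true, t) :: (i, false, t0) :: w
  end).
apply: (circuit_mutates cw).
- apply/permP => P; rewrite /wlab.
  by case: (d); case: (d0); rewrite /= !count_cat /= ?count_cat; clear; lia.
- by move: wp; case: (d); case: (d0).
- by move: wm; case: (d); case: (d0).
pose R x y := tarr t0 x y + tarr t x y + chain w p x y.
have RN x : R x i = 0 /\ R i x = 0.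
  rewrite /R !(tarr_notin (t := t)) ?it ?orbT // !(tarr_notin (t := t0)) ?it0 ?orbT //.
  by have [-> ->] := chain_notin ip iw x.
case: (d0); case: (d).
- apply: (@mutates_tri _ i _ _ _ _ _ _ R r0i pi qi ri RN) => x y;
  rewrite /= /seg /R /=.
    by rewrite (tri_rot (Some p)) ; addn_ac.
  by rewrite -(tri_rot (Some i)); addn_ac.
- apply: (@mutates_tri _ i _ _ _ _ _ _ R r0i pi ri qi RN) => x y;
  rewrite /= /seg /R /=.
    by rewrite (tri_rot (Some p)) (tri_rot (Some (start w p))); addn_ac.
  by addn_ac.
- apply: (@mutates_tri _ i _ _ _ _ _ _ R pi r0i qi ri RN) => x y;
  rewrite /= /seg /R /=.
    by addn_ac.
  by rewrite (tri_rot (Some p)) (tri_rot (Some (start w p))); addn_ac.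
- apply: (@mutates_tri _ i _ _ _ _ _ _ R pi r0i ri qi RN) => x y;
  rewrite /= /seg /R /=.
    by rewrite (tri_rot (Some (start w p))); addn_ac.
  by rewrite -(tri_rot (Some i)); addn_ac.
Qed.

Lemma wlab_split (S : eqType) (w : seq (segment S)) i : i \in wlab w ->
  exists w1 s w2, w = w1 ++ s :: w2 /\ i \in s.1.1 :: lab s.2.
Proof.
elim: w => //= s w IH; rewrite /wlab /= -cat_cons mem_cat => /orP[iN|].
  by exists [::], s, w.
by case/IH=> w1 [s' [w2 [-> ?]]]; exists (s :: w1), s', w2.
Qed.

Lemma circuit_mutation (T : finType) (Q : quiver T) w i :
  circuit Q w -> exists w', circuit (mutation Q i) w'.
Proof.
move=> cw; have [_ /(_ i)/wlab_split[w1 [[[c d] t] [w2 [wE iN]]]] _] := cw.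
move: cw iN; rewrite {w}wE inE => /circuit_catC; rewrite cat_cons => cw.
case/predU1P=> [/= ic|]; last exact: circuit_mutation_tree cw.
rewrite -{}ic in cw; have [aw _ _] := cw; move: (w2 ++ w1) cw aw => w cw.
(* The list starts at [i], so the predecessor of [i] on the cycle is its last segment; it is then
   brought to the front. *)
move/annular_size; case/lastP: w cw => // w [[p d0] t0] cw _.
apply: (@circuit_mutation_vertex _ _ p d0 t0 i d t w).
by move: cw; rewrite -cats1 -cat_cons => /circuit_catC.
Qed.

Lemma orb_addn (a b : bool) n : a + b = n.+1 -> a || b.
Proof. by case: a b => [] []. Qed.

(** * Non-oriented cycles as full subquivers, and why hanging trees avoid them *)

Section Cycles.

Variables (T : finType) (Q : quiver T).
Implicit Types (C : {set T}) (c : seq T).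

Definition cycle_on C c :=
  [/\ uniq c, c =i C & 1 < size c] /\
  {in C &, forall x y, nedges Q x y = (y == next c x) + (x == next c y)} /\
  ~ (cycle (fun x y => 0 < arr Q x y) c \/
     cycle (fun x y => 0 < arr Q y x) c).

Lemma nonoriented_cycleP C :
  nonoriented_cycle (full_subquiver Q C) <-> exists c, cycle_on C c.
Proof.
split=> [[c [[uc all_c c2] [nE nc]]]|[c [[uc cC c2] [nE nc]]]].
  exists (map val c); split; last split.
  - rewrite (map_inj_uniq val_inj) size_map; split=> // x.
    apply/mapP/idP => [[[y yC] _ ->] //|xC].
    by exists (Sub x xC); rewrite ?SubK.
  - move=> x y xC yC; have := nE (Sub x xC) (Sub y yC).
    rewrite /nedges /= /full_arr !SubK => ->.
    have nE' z (zC : z \in C) : next (map val c) z = val (next c (Sub z zC)).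
      by rewrite -(next_map val_inj) // SubK.
    by rewrite !nE' -!(inj_eq val_inj) !SubK.
  - by rewrite !cycle_map.
have [c' c'E] : exists c' : seq {x : T | x \in C}, map val c' = c.
  have : {subset c <= C} by move=> x; rewrite cC.
  elim: (c) => [|x s IH] sC; first by exists [::].
  have [|s' <-] := IH; first by move=> y ys; apply: sC; rewrite inE ys orbT.
  by exists (Sub x (sC x (mem_head _ _)) :: s').
have uc' : uniq c' by rewrite -(map_inj_uniq val_inj) c'E.
exists c'; split; last split.
- split=> //; last by rewrite -(size_map val) c'E.
  by move=> x; rewrite -(mem_map val_inj) c'E cC; apply: valP.
- move=> x y; rewrite /nedges /= /full_arr.
  have := nE _ _ (valP x) (valP y); rewrite /nedges => ->.
  by rewrite -c'E !(next_map val_inj) // !(inj_eq val_inj).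
- by move: nc; rewrite -c'E !cycle_map.
Qed.

Lemma next_closed c (P : {pred T}) x : uniq c ->
  (forall y, y \in c -> y \in P -> next c y \in P) ->
  x \in c -> x \in P -> {subset c <= P}.
Proof.
move=> uc cP xc xP y yc.
have /iter_findex <- : fconnect (next c) x y.
  by rewrite (fconnect_cycle (cycle_next uc)).
elim: (findex _ _ _) => //= n IH; apply: cP => //.
by elim: n {IH} => //= n IH; rewrite mem_next.
Qed.

(** The two neighbours of [v] on the cycle would be [o1] and [o2], so the cycle
    would be the oriented triangle [v -> o1 -> o2 -> v]. *)
Lemma cycle_on_triangle C c v o1 o2 : cycle_on C c -> v \in C ->
  {in C, forall y, arr Q v y = (o1 == Some y) /\ arr Q y v = (o2 == Some y)} ->
  (forall u w, o1 = Some u -> o2 = Some w -> 0 < arr Q u w) -> False.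
Proof.
move=> [[uc cC _] [nE nc]] vC vE uw.
have nC x : (next c x \in C) = (x \in C) by rewrite -!cC mem_next.
have pC : prev c v \in C by rewrite -cC mem_prev cC.
have n1 : (o1 == Some (next c v)) || (o2 == Some (next c v)).
  have [e1 e2] := vE (next c v) (etrans (nC v) vC).
  have := nE v (next c v) vC (etrans (nC v) vC).
  by rewrite /nedges e1 e2 eqxx; apply: orb_addn.
have n2 : (o1 == Some (prev c v)) || (o2 == Some (prev c v)).
  have [e1 e2] := vE _ pC; have := nE v _ vC pC.
  by rewrite /nedges e1 e2 next_prev // eqxx [RHS]addnC; apply: orb_addn.
have o12 u : o1 = Some u -> o2 = Some u -> u \in C -> False.
  move=> e1 e2 uC; have [a1 a2] := vE u uC.
  by have := @arr_no2cycle _ Q v u; rewrite a1 a2 e1 e2 eqxx => /(_ isT).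
(* Equal neighbours mean a cycle of length two with two edges; [vE] would make these one arrow each
   way, a 2-cycle. *)
have np : next c v != prev c v.
  apply/eqP => npE; have := nE v (next c v) vC (etrans (nC v) vC).
  have [e1 e2] := vE _ (etrans (nC v) vC); rewrite /nedges e1 e2.
  have -> : next c (next c v) = v by rewrite npE next_prev.
  rewrite !eqxx.
  case: eqP => // e1'; case: eqP => // e2' _; apply: (o12 _ e1' e2'); by rewrite nC.
suff [u [w [uC wC o1u [o2w cE]]]] : exists u w, [/\ u \in C, w \in C, o1 = Some u &
    o2 = Some w /\ ((next c v = u /\ next c w = v) \/ (next c v = w /\ next c u = v))].
  have uwE := nE u w uC wC; have a3 := uw u w o1u o2w.
  have [a1 _] := vE u uC; have [_ a2] := vE w wC.
  rewrite o1u eqxx in a1; rewrite o2w eqxx in a2.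
  have uw_neq : u != w by apply: contraTneq a3 => ->; rewrite arr_loopless.
  have vc : v \in c by rewrite cC.
  have next_inj : injective (next c) := can_inj (prev_next uc).
  apply: nc; case: cE => [[nv nw]|[nv nu]].
    have nu : next c u = w.
      have uv : u != v.
        by apply: contra_neq uw_neq => uv; apply: next_inj; rewrite nw uv nv uv.
      case: (eqVneq w (next c u)) => // wu; case: (eqVneq u (next c w)) => [uw'|uw'].
        by rewrite uw' nw eqxx in uv.
      by move: uwE; rewrite /nedges (negbTE wu) (negbTE uw') addn0 => /eqP;
        rewrite addn_eq0 => /andP[/eqP a0 _]; rewrite a0 in a3.
    left; apply: cycle_from_next => // x xc.
    have : x \in [:: v; u; w].
      apply: (@next_closed c (mem [:: v; u; w]) v) => //; last by rewrite inE eqxx.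
      by move=> y _; rewrite !inE => /or3P[]/eqP->; rewrite ?nv ?nu ?nw eqxx ?orbT.
    by rewrite !inE => /or3P[]/eqP->; rewrite ?nv ?nu ?nw ?a1 ?a2 ?a3.
  have nw : next c w = u.
    have wv : w != v.
      by apply: contra_neq uw_neq => wv; apply: next_inj; rewrite nu wv nv wv.
    case: (eqVneq u (next c w)) => // wu; case: (eqVneq w (next c u)) => [uw'|uw'].
      by rewrite uw' nu eqxx in wv.
    by move: uwE; rewrite /nedges (negbTE wu) (negbTE uw') addn0 => /eqP;
        rewrite addn_eq0 => /andP[/eqP a0 _]; rewrite a0 in a3.
  right; apply: cycle_from_next => // x xc.
  have : x \in [:: v; u; w].
    apply: (@next_closed c (mem [:: v; u; w]) v) => //; last by rewrite inE eqxx.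
    by move=> y _; rewrite !inE => /or3P[]/eqP->; rewrite ?nv ?nu ?nw eqxx ?orbT.
  by rewrite !inE => /or3P[]/eqP->; rewrite ?nv ?nu ?nw ?a1 ?a2 ?a3.
have nvp := next_prev uc v.
case/orP: n1 => /eqP e1; case/orP: n2 => /eqP e2.
- by move: np; rewrite e1 in e2; case: e2 => ->; rewrite eqxx.
- by exists (next c v), (prev c v); split; rewrite ?nC //; split=> //; left.
- by exists (prev c v), (next c v); split; rewrite ?nC //; split=> //; right.
- by move: np; rewrite e1 in e2; case: e2 => ->; rewrite eqxx.
Qed.

Lemma cycle_on_degree C c v : cycle_on C c -> v \in C ->
  \sum_(y in C) nedges Q v y = 2.
Proof.
move=> [[uc cC _] [nE _]] vC.
have nC : next c v \in C by rewrite -cC mem_next cC.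
have pC : prev c v \in C by rewrite -cC mem_prev cC.
have sum1 z : z \in C -> \sum_(y in C) (y == z) = 1.
  by move=> zC; rewrite (bigD1 z) //= eqxx big1 // => y /andP[_ /negbTE->].
rewrite (eq_bigr (fun y => (y == next c v) + (y == prev c v))) => [|y yC].
  by rewrite big_split /= !sum1.
by rewrite nE // [v == _]eq_sym (can2_eq (prev_next uc) (next_prev uc)).
Qed.

(** A vertex of [C'] already has its two edges inside [C'], so its successor on the larger cycle
    cannot lie outside. Hence [C'] is closed under [next] and is everything. *)
Lemma cycle_on_subset C C' c c' :
  cycle_on C c -> cycle_on C' c' -> C' \subset C -> C' = C.
Proof.
move=> cycC cycC' /subsetP sub; have [[uc cC _] [nE _]] := cycC.
have [x0 x0C'] : exists x, x \in C'.
  have [[_ c'C c2] _] := cycC'; case: (c') c'C c2 => // x s sC.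
  by exists x; rewrite -sC mem_head.
apply/setP => x; apply/idP/idP => [/sub //|].
rewrite -cC; apply: (@next_closed c (mem C') x0) => //; last by rewrite cC sub.
move=> v _ vC'; apply: contraT => nC'.
have nC : next c v \in C by rewrite -cC mem_next cC sub.
have := cycle_on_degree cycC (sub v vC').
rewrite (bigID (mem C')) /= (eq_bigl (mem C')) => [|y]; last first.
  by apply: andb_idl; apply: sub.
rewrite (cycle_on_degree cycC' vC') (bigD1 (next c v)) /= ?nC //.
by rewrite (nE v (next c v) (sub v vC') nC) eqxx -[RHS]addn0 => /addnI.
Qed.

(** The options [o1] and [o2] are the other corners of the block that attaches the root of [t] to
    the rest. In the induction the subtrees come first, each attached by the block of its parent;
    the root is then left with [o1] and [o2] as its only possible neighbours on a cycle. *)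
Lemma tree_not_on_cycle C c t o1 o2 : cycle_on C c -> uniq (lab t) ->
  (forall x y, x \in lab t ->
     arr Q x y = tarr t x y + (troot t == Some x) && (o1 == Some y) /\
     arr Q y x = tarr t y x + (troot t == Some x) && (o2 == Some y)) ->
  (forall u w, o1 = Some u -> o2 = Some w -> 0 < arr Q u w) ->
  {in lab t, forall x, x \notin C}.
Proof.
move=> cyc; elim: t o1 o2 => //= v A IHA B IHB o1 o2.
move=> /andP[]; rewrite mem_cat negb_or => /andP[vA vB] uAB tE o12.
have uA : uniq (lab A) by move: uAB; rewrite cat_uniq => /and3P[].
have uB : uniq (lab B) by move: uAB; rewrite cat_uniq => /and3P[].
have AC : {in lab A, forall x, x \notin C}.
  apply: (IHA (troot B) (Some v)) => // [x y xA|u w rB [<-]].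
    have xv : (Some v == Some x) = false by apply: contraNF vA => /eqP[->].
    have xB := uniq_cat_notin uAB xA.
    have [|-> ->] := tE x y; rewrite ?inE ?mem_cat ?xA ?orbT //.
    rewrite xv /= !(tarr_notin (t := B)) ?xB ?orbT // !addn0.
    rewrite /tri /link xv (root_notin xB) !andbF /= !addn0 ?add0n.
    by split; rewrite addnC // andbC.
  have uB' := root_lab rB; have [|-> _] := tE u v.
    by rewrite inE mem_cat uB' !orbT.
  by rewrite /tri /link rB !eqxx /= !addn_gt0 ?orbT.
have BC : {in lab B, forall x, x \notin C}.
  apply: (IHB (Some v) (troot A)) => // [x y xB|u w [<-] rA].
    have xv : (Some v == Some x) = false by apply: contraNF vB => /eqP[->].
    have xA : x \notin lab A by apply: contraTN xB => /(uniq_cat_notin uAB).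
    have [|-> ->] := tE x y; rewrite ?inE ?mem_cat ?xB ?orbT //.
    rewrite xv /= !(tarr_notin (t := A)) ?xA ?orbT // !add0n !addn0.
    rewrite /tri /link xv (root_notin xA) !andbF /= !addn0 ?add0n.
    by split; rewrite addnC // andbC.
  have wA := root_lab rA; have [|_ ->] := tE w v.
    by rewrite inE mem_cat wA !orbT.
  by rewrite /tri /link rA !eqxx /= !addn_gt0 ?orbT.
move=> x; rewrite inE mem_cat => /predU1P[->|/orP[/AC|/BC]] //.
apply/negP => vC; apply: (cycle_on_triangle cyc vC) o12 => y yC.
have yA : y \notin lab A by apply: contraTN yC => /AC.
have yB : y \notin lab B by apply: contraTN yC => /BC.
have [|-> ->] := tE v y; first by rewrite mem_head.
rewrite !(tarr_notin (t := A)) ?vA ?orbT // !(tarr_notin (t := B)) ?vB ?orbT //.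
rewrite /tri /link !(root_notin vA) !(root_notin vB) !(root_notin yA).
by rewrite !(root_notin yB) eqxx !andbF.
Qed.

End Cycles.

(** * Matching the arrows of the cycle with its vertices *)

Section Arrows.

Variables (T : finType) (Q : quiver T).
Implicit Types (C : {set T}) (c : seq T) (a b : arrow Q).

Lemma arrow_gt0 a : 0 < arr Q (src a) (tgt a).
Proof. exact: leq_ltn_trans (ltn_ord (tagged a)). Qed.

Lemma arrow_eq a b : src a = src b -> tgt a = tgt b ->
  tagged a = tagged b :> nat -> a = b.
Proof.
case: a b => [[u v] i] [[u' v'] j]; rewrite /src /tgt /= => uu vv.
by subst u' v' => /val_inj ->.
Qed.

Lemma ex_arrow u v k : k < arr Q u v ->
  exists a, [/\ src a = u, tgt a = v & tagged a = k :> nat].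
Proof.
move=> k_lt.
by exists (Tagged (fun xy => 'I_(arr Q xy.1 xy.2))
  (Ordinal k_lt : 'I_(arr Q (u, v).1 (u, v).2))).
Qed.

Definition ends c a x :=
  (src a = x /\ tgt a = next c x) \/ (src a = next c x /\ tgt a = x).

(** The class is described arrow by arrow, circuits vertex by vertex; [alpha x] is the arrow between
    [x] and its successor. On a double arrow the ends do not determine the arrow, and a rank must
    tell the two apart. *)
Lemma cycle_on_arrows C c : cycle_on Q C c -> exists alpha : T -> arrow Q,
  [/\ {in C, forall x, ends c (alpha x) x}, {in C &, injective alpha} &
      forall a, src a \in C -> tgt a \in C -> exists2 x, x \in C & alpha x = a].
Proof.
move=> [[uc cC c2] [nE _]].
have nC x : x \in C -> next c x \in C by rewrite -!cC mem_next.
have [h hC] : exists h, h \in C.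
  by case: (c) cC c2 => // x s sC; exists x; rewrite -sC mem_head.
(* [k x] is the rank of [alpha x] among the parallel arrows: on a double arrow
   the vertex [h] gets the first one. *)
pose k x : nat := (next c (next c x) == x) && (x != h).
have hE x : x \in C -> next c (next c x) = x -> (h == x) || (h == next c x).
  move=> xC nn; have sub : {subset c <= pred2 x (next c x)}.
    apply: (@next_closed T c _ x) => //; rewrite ?cC ?inE ?eqxx //.
    by move=> y _; rewrite !inE => /orP[]/eqP->; rewrite ?nn eqxx ?orbT.
  by have := sub h; rewrite cC !inE; apply.
have ex x : x \in C -> exists a, ends c a x /\ tagged a = k x :> nat.
  move=> xC; have := nE x _ xC (nC x xC); rewrite eqxx eq_sym /nedges.
  have kle : k x <= (next c (next c x) == x).
    by rewrite /k; case: (next _ _ == x); rewrite ?leq_b1.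
  case: (posnP (arr Q x (next c x))) => [-> aE|a0].
    have [|a [a1 a2 a3]] := @ex_arrow (next c x) x (k x); first by lia.
    by exists a; split=> //; right.
  rewrite (arr_no2cycle a0) => aE.
  have [|a [a1 a2 a3]] := @ex_arrow x (next c x) (k x); first by lia.
  by exists a; split=> //; left.
have [a0 _] := ex h hC.
have [x|alpha alphaE] := @fin_all_exists T (fun=> arrow Q)
  (fun x a => x \in C -> ends c a x /\ tagged a = k x :> nat).
  by case: (boolP (x \in C)) => [/ex[a]|]; [exists a|exists a0].
exists alpha; split=> [x /alphaE[] //|x y xC yC eqa|a uC vC].
  have [ex1 kx] := alphaE x xC; have [ey1 ky] := alphaE y yC.
  rewrite -eqa in ey1 ky; apply/eqP/negPn/negP => xy.
  have [xny ynx] : x = next c y /\ y = next c x.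
    case: ex1 ey1 => -[s1 t1] [] [s2 t2].
    - by case/eqP: xy; congruence.
    - by split; congruence.
    - by split; congruence.
    - by case/eqP: xy; congruence.
  have := hE x xC; rewrite -ynx -xny => /(_ erefl).
  move: kx; rewrite ky /k -ynx -xny -ynx !eqxx /= => + hxy.
  by case/orP: hxy => /eqP ->; rewrite eqxx ?xy // eq_sym xy.
have alpha_ends x : x \in C -> ends c a x -> ends c (alpha x) x ->
    src (alpha x) = src a /\ tgt (alpha x) = tgt a.
  move=> xC; have := arrow_gt0 a; have := arrow_gt0 (alpha x).
  move=> + + [] [e1 e2] [] [f1 f2]; rewrite e1 e2 f1 f2 => // p1.
    by rewrite (arr_no2cycle p1).
  by rewrite (arr_no2cycle p1).
have [m mE] : exists m, m = tagged a :> nat by exists (tagged a).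
have k_lt : m < arr Q (src a) (tgt a) by rewrite mE; apply: ltn_ord.
have fin x : x \in C -> ends c a x -> m = k x ->
    exists2 x, x \in C & alpha x = a.
  move=> xC ax ka; exists x => //; have [ex1 kx] := alphaE x xC.
  by have [s1 t1] := alpha_ends x xC ax ex1; apply: arrow_eq; rewrite // -mE ka kx.
have neE := nE _ _ uC vC; rewrite /nedges (arr_no2cycle (arrow_gt0 a)) addn0 in neE.
have uv : src a != tgt a.
  by apply: contraTneq (arrow_gt0 a) => ->; rewrite arr_loopless.
case: (eqVneq (tgt a) (next c (src a))) neE => [vE|vE].
  have au : ends c a (src a) by left.
  case: (eqVneq (src a) (next c (tgt a))) => [uE|uE] neE; last first.
    apply: (fin (src a)) => //.
    by rewrite /k -vE eq_sym (negbTE uE); move: k_lt; rewrite neE; case: (m).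
  have av : ends c a (tgt a) by right.
  have ku : k (src a) = (src a != h) by rewrite /k -vE -uE eqxx.
  have kv : k (tgt a) = (tgt a != h) by rewrite /k -uE -vE eqxx.
  have := hE _ uC; rewrite -vE -uE => /(_ erefl) hh.
  have kk : k (tgt a) = 1 - k (src a).
    by rewrite ku kv; case/orP: hh => /eqP->; rewrite eqxx ?uv // eq_sym uv.
  case: (eqVneq m (k (src a))) => [|ka]; first exact: fin.
  apply: (fin (tgt a)) => //; rewrite kk; move: ka k_lt; rewrite neE ku.
  by case: (src a != h); case: (m) => [|[|]].
case: (eqVneq (src a) (next c (tgt a))) => [uE|_] neE;
  last by move: (arrow_gt0 a); rewrite neE.
apply: (fin (tgt a)) => //; first by right.
by rewrite /k -uE eq_sym (negbTE vE); move: k_lt; rewrite neE; case: (m).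
Qed.

End Arrows.

Lemma next_cat (S : eqType) (p1 p2 : seq S) v : uniq (p1 ++ v :: p2) ->
  next (p1 ++ v :: p2) v = head (head v p1) p2.
Proof.
move=> up; rewrite -(next_rot (size p1) up) rot_size_cat.
by case: p2 {up} => [|y p2]; case: p1 => [|z p1] /=; rewrite eqxx.
Qed.

Lemma sum_only (S : eqType) (c : seq S) (F : S -> nat) v0 : uniq c -> v0 \in c ->
  (forall v, v \in c -> v != v0 -> F v = 0) -> \sum_(v <- c) F v = F v0.
Proof.
move=> uc vc F0; rewrite (bigD1_seq v0) //= big1_seq ?addn0 // => v /andP[vv0 vc'].
exact: F0.
Qed.

(** Since [alpha] and [z] are injective, at most one vertex contributes. This identifies the count
    coming from a circuit with the boolean in the definition of the class. *)
Lemma sum_exists (S : eqType) (A : finType) (L : eqType) (c : seq S)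
    (alpha : S -> A) (D : {set A}) (z : A -> L) (o : S -> option L)
    (P : pred A) (x : L) :
  uniq c -> {in c &, injective alpha} -> {in D &, injective z} ->
  (forall a, a \in D -> exists2 v, v \in c & alpha v = a) ->
  {in c, forall v, o v = if alpha v \in D then Some (z (alpha v)) else None} ->
  \sum_(v <- c) (P (alpha v) && (o v == Some x)) =
    [exists a in D, (z a == x) && P a].
Proof.
move=> uc alpha_inj z_inj D_alpha oE.
case: (boolP [exists a in D, _]) => [/exists_inP[a aD /andP[/eqP za Pa]]|noa].
  have [v0 v0c v0a] := D_alpha a aD.
  rewrite (sum_only (v0 := v0)) // => [|v vc vv0].
    by rewrite oE // v0a aD za eqxx Pa.
  rewrite oE //; case: ifP => [vD|_]; last by rewrite andbF.
  case: eqP => [[zx]|_]; last by rewrite andbF.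
  case/eqP: vv0; apply: alpha_inj => //; rewrite v0a.
  by apply: z_inj => //; rewrite zx za.
rewrite big1_seq // => v /andP[_ vc]; rewrite oE //.
case: ifP => [vD|_]; last by rewrite andbF.
case: eqP => [[zx]|_]; last by rewrite andbF.
rewrite andbT; apply/eqP; rewrite eqb0; apply: contra noa => Pv.
by apply/exists_inP; exists (alpha v); rewrite // zx eqxx.
Qed.

(** * Circuits given by functions on the vertices of the cycle *)

Section CircuitOf.

Variables (L : eqType) (c : seq L) (d : L -> bool) (t : L -> btree L).
Hypothesis uc : uniq c.

Definition circuit_of : seq (segment L) := [seq (v, d v, t v) | v <- c].

Definition seg_src v := if d v then v else next c v.
Definition seg_tgt v := if d v then next c v else v.

Lemma circ_sum x y : circ circuit_of x y = \sum_(v <- c)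
  (tri (Some (seg_src v)) (Some (seg_tgt v)) (troot (t v)) x y + tarr (t v) x y).
Proof.
have startE p e : start [seq (v, d v, t v) | v <- p] e = head e p by case: p.
case cE: c => [|h c']; first by rewrite /circuit_of cE big_nil.
have -> : circ circuit_of x y = chain circuit_of h x y.
  by rewrite /circuit_of cE.
(* Induction over the suffixes [p2] of [c], with the prefix kept to compute [next]; the successor of
   the last vertex wraps around to [h]. *)
rewrite -cE /circuit_of; have : c = [::] ++ c by [].
move: {2 3 4}c [::]; elim=> [|v p2 IH] p1 cp; rewrite ?big_nil // big_cons /=.
rewrite (IH (rcons p1 v)) ?cat_rcons // startE; congr (_ + _).
have -> : head h p2 = next c v.
  rewrite cp next_cat -?cp //; case: (p2) cp => //=; case: (p1) => [|? ?];
  by rewrite cE => -[].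
by rewrite /seg /seg_src /seg_tgt; case: (d v).
Qed.

Lemma seg_ends_mem v : v \in c -> (seg_src v \in c) && (seg_tgt v \in c).
Proof. by move=> vc; rewrite /seg_src /seg_tgt; case: ifP; rewrite mem_next vc. Qed.

Hypothesis tc : {in c, forall v, {in lab (t v), forall x, x \notin c}}.

Let root_in v x : v \in c -> x \in c -> (troot (t v) == Some x) = false.
Proof.
by move=> vc xc; apply: root_notin; apply: contraL xc; apply: tc.
Qed.

Let tarr_in v x y : v \in c -> (x \in c) || (y \in c) -> tarr (t v) x y = 0.
Proof.
move=> vc xy; rewrite tarr_notin //.
by case/orP: xy => xc; apply/orP; [left|right]; apply: contraL xc; apply: tc.
Qed.

Let end_out v x : v \in c -> x \notin c ->
  ((Some (seg_src v) == Some x) = false) * ((Some (seg_tgt v) == Some x) = false).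
Proof.
move=> vc xc; have /andP[sc gc] := seg_ends_mem vc.
by split; apply: contraNF xc => /eqP[<-].
Qed.

Lemma circ_in x y : x \in c -> y \in c ->
  circ circuit_of x y = \sum_(v <- c) ((seg_src v == x) && (seg_tgt v == y)).
Proof.
move=> xc yc; rewrite circ_sum; apply: eq_big_seq => v vc.
by rewrite tarr_in ?xc // /tri /link !root_in // !andbF !addn0.
Qed.

Lemma circ_from x y : x \in c -> y \notin c ->
  circ circuit_of x y =
    \sum_(v <- c) ((seg_tgt v == x) && (troot (t v) == Some y)).
Proof.
move=> xc yc; rewrite circ_sum; apply: eq_big_seq => v vc.
by rewrite tarr_in ?xc // /tri /link (root_in vc xc) !(end_out vc yc) !andbF !addn0.
Qed.

Lemma circ_to x y : x \notin c -> y \in c ->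
  circ circuit_of x y =
    \sum_(v <- c) ((seg_src v == y) && (troot (t v) == Some x)).
Proof.
move=> xc yc; rewrite circ_sum; apply: eq_big_seq => v vc.
rewrite tarr_in ?yc ?orbT // /tri /link (root_in vc yc) !(end_out vc xc).
by rewrite !andbF /= andbC addn0 add0n.
Qed.

Lemma circ_out x y : x \notin c -> y \notin c ->
  circ circuit_of x y = \sum_(v <- c) tarr (t v) x y.
Proof.
move=> xc yc; rewrite circ_sum; apply: eq_big_seq => v vc.
by rewrite /tri /link !(end_out vc xc) !(end_out vc yc) !andbF.
Qed.

Lemma circ_nedges x y : x \in c -> y \in c ->
  circ circuit_of x y + circ circuit_of y x = (y == next c x) + (x == next c y).
Proof.
have sum1 u w : u \in c -> \sum_(v <- c) ((v == u) && (next c v == w)) = (w == next c u).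
  move=> uC; rewrite (sum_only (v0 := u)) // => [|v _ /negbTE->] //.
  by rewrite eqxx eq_sym.
move=> xc yc; rewrite !circ_in // -!sum1 // -!big_split; apply: eq_bigr => v _ /=.
rewrite /seg_src /seg_tgt; case: ifP => _ //.
by rewrite addnC andbC (andbC (next c v == _)).
Qed.

End CircuitOf.

Lemma circuit_of_fst (L : eqType) (w : seq (segment L)) :
  uniq [seq s.1.1 | s <- w] ->
  exists d t, w = circuit_of [seq s.1.1 | s <- w] d t.
Proof.
elim: w => [|[[c0 d0] t0] w IH] /=; first by exists (fun=> true), (fun=> E).
case/andP=> c0w /IH[d [t wE]].
exists (fun v => if v == c0 then d0 else d v), (fun v => if v == c0 then t0 else t v).
rewrite /circuit_of /= eqxx; congr (_ :: _); rewrite {1}wE.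
apply/eq_in_map => v vw; rewrite (negbTE (_ : v != c0)) //.
by apply: contraNneq c0w => <-.
Qed.

(** * The quivers of the class are the connected circuits *)

Lemma uniq_flatten (S R : eqType) (c : seq S) (F : S -> seq R) :
  uniq c -> {in c, forall v, uniq (F v)} ->
  {in c &, forall v v', v != v' -> {in F v, forall e, e \notin F v'}} ->
  uniq (flatten [seq F v | v <- c]).
Proof.
elim: c => //= v c IH /andP[vc uc] uF dF; rewrite cat_uniq uF ?mem_head //=.
rewrite IH // => [|x xc|x y xc yc]; last 2 first.
- by apply: uF; rewrite inE xc orbT.
- by apply: dF; rewrite inE ?xc ?yc orbT.
rewrite andbT; apply/hasPn => e /flattenP[_ /mapP[v' v'c ->]] ev'.
by apply: (dF v' v) ev'; rewrite ?inE ?eqxx ?v'c ?orbT //; apply: contraNneq vc => <-.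
Qed.

Lemma uniq_flatten_disj (S R : eqType) (c : seq S) (F : S -> seq R) :
  uniq (flatten [seq F v | v <- c]) -> {in c, forall v, uniq (F v)} /\
  (uniq c -> {in c &, forall v v', v != v' -> {in F v, forall e, e \notin F v'}}).
Proof.
elim: c => //= v c IH ufl; have := ufl.
rewrite cat_uniq => /and3P[uv dv /IH{IH}[uF dF]].
have FE v' e : v' \in c -> e \in F v' -> e \in flatten [seq F v | v <- c].
  by move=> v'c ev'; apply/flattenP; exists (F v') => //; apply: map_f.
split=> [x|/andP[vc uc] x y]; first by rewrite inE => /predU1P[->|/uF].
rewrite !inE => /predU1P[->|xc] /predU1P[->|yc]; rewrite ?eqxx // => xy e ex.
- by apply: contra (uniq_cat_notin ufl ex); apply: FE.
- apply/negP => ev; have := uniq_cat_notin ufl ev.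
  by rewrite (FE x).
- exact: (dF uc x y).
Qed.

(** An edge can disappear only if both its ends are neighbours of [i]; these remain joined through
    [i], whose arrows are merely reversed. *)
Lemma mutation_connected (T : finType) (Q : quiver T) i :
  connected Q -> connected (mutation Q i).
Proof.
move=> cQ x y; pose e u v := 0 < nedges (mutation Q i) u v.
have ei u : 0 < nedges Q i u -> e i u.
  by rewrite /e /nedges /= /mut_arr eqxx orbT /= addnC.
have e_sym : symmetric e by move=> u v; rewrite /e /nedges addnC.
have sub u v : 0 < nedges Q u v -> connect e u v.
  move=> uv; have [ui|ui] := eqVneq u i; first by apply: connect1; rewrite ui ei // -ui.
  have [vi|vi] := eqVneq v i.
    by apply: connect1; rewrite e_sym vi ei // /nedges addnC -vi.
  have [iu|iu] := boolP ((0 < nedges Q i u) && (0 < nedges Q i v)).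
    case/andP: iu => /ei iu /ei iv.
    by apply: (connect_trans (y := i)); apply: connect1; rewrite // e_sym.
  apply: connect1; rewrite /e /nedges /= /mut_arr (negbTE ui) (negbTE vi) /=.
  have -> : arr Q u i * arr Q i v = 0.
    by apply/eqP; rewrite muln_eq0; move: iu; rewrite negb_and /nedges; lia.
  have -> : arr Q v i * arr Q i u = 0.
    by apply/eqP; rewrite muln_eq0; move: iu; rewrite negb_and /nedges; lia.
  move: uv (@arr_no2cycle _ Q u v) (@arr_no2cycle _ Q v u); rewrite /nedges.
  by rewrite !addn0; lia.
by apply: connect_sub (cQ x y) => u v; apply: sub.
Qed.

Lemma wlab_circuit_of (L : eqType) (c : seq L) d t :
  wlab (circuit_of c d t) = flatten [seq v :: lab (t v) | v <- c].
Proof. by rewrite /wlab /circuit_of -map_comp. Qed.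

Lemma classQ_circuit n (T : finType) (Q : quiver T) :
  classQ n Q -> exists w, circuit Q w.
Proof.
move=> [_ _ [C [[nC _] [D [z [V [[Dends zinj CV] [Vcov Vdisj Vtree]]]]]]]].
have [c cyc] := (nonoriented_cycleP Q C).1 nC.
have [alpha [aends ainj asurj]] := cycle_on_arrows cyc.
have [[uc cC c2] [nE nonor]] := cyc.
have trees a : exists ta : btree T, a \in D -> [/\ uniq (lab ta), lab ta =i V a,
    troot ta = Some (z a) & {in V a &, arr Q =2 tarr ta}].
  case: (boolP (a \in D)) => [aD|]; last by exists E.
  have [w [wz /rooted_typeA_tree[t [ut all_t rt tE]]]] := Vtree a aD.
  exists (tmap val t) => _; rewrite lab_tmap troot_tmap rt /= wz.
  split=> // [|x|x y xV yV].
  - by rewrite (map_inj_uniq val_inj).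
  - apply/mapP/idP => [[y _ ->]|xV]; first exact: valP.
    by exists (Sub x xV); rewrite ?SubK.
  - have := tE (Sub x xV) (Sub y yV).
    by rewrite -(tarr_tmap _ _ _ val_inj) /= /full_arr !SubK.
have [tr trE] := @fin_all_exists _ (fun=> btree T) _ trees.
pose d v := src (alpha v) == v.
pose t v := if alpha v \in D then tr (alpha v) else E.
have segE v : v \in c ->
    (seg_src c d v = src (alpha v)) * (seg_tgt c d v = tgt (alpha v)).
  rewrite cC /seg_src /seg_tgt /d => /aends[] [sE tE];
    rewrite sE tE ?eqxx; first by split.
  have := arrow_gt0 (alpha v); rewrite sE tE; case: eqP => [->|_]; last by split.
  by rewrite arr_loopless.
have VC a x : a \in D -> x \in V a -> x \notin C.
  by move=> aD xV; rewrite -in_setC -Vcov; apply/bigcupP; exists a.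
have labV v x : x \in lab (t v) -> alpha v \in D /\ x \in V (alpha v).
  by rewrite /t; case: ifP => // vD; have [_ -> _ _] := trE _ vD.
have tc : {in c, forall v, {in lab (t v), forall x, x \notin c}}.
  by move=> v _ x /labV[vD xV]; rewrite cC; apply: VC xV.
have all_lab x : x \in wlab (circuit_of c d t).
  rewrite wlab_circuit_of; apply/flattenP; case: (boolP (x \in C)) => xC.
    by exists (x :: lab (t x)); rewrite ?mem_head //; apply/mapP; exists x; rewrite ?cC.
  move: xC; rewrite -in_setC -Vcov => /bigcupP[a aD xV].
  have [sC gC _] := Dends a aD; have [v vC va] := asurj a sC gC.
  exists (v :: lab (t v)); first by apply/mapP; exists v; rewrite ?cC.
  by rewrite inE /t va aD; have [_ -> _ _] := trE _ aD; rewrite xV orbT.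
exists (circuit_of c d t); split=> //.
  apply/and3P; split.
  - rewrite wlab_circuit_of; apply: uniq_flatten => // [v vc|v v' vc v'c vv' e].
      rewrite /= (contraL (tc v vc v)) // /t; case: ifP => // vD.
      by have [] := trE _ vD.
    rewrite !inE negb_or => /predU1P[->|ev].
      by rewrite vv'; apply: contraL vc; apply: tc.
    have /negbTE ev' : e != v' by apply: contraTneq (tc v vc e ev) => ->; rewrite v'c.
    rewrite ev' /=; apply/negP => /labV[v'D eV']; have [vD eV] := labV v e ev.
    have aa : alpha v != alpha v' by apply: contra_neq vv' => /ainj; rewrite -!cC; apply.
    have [dV _] := Vdisj _ _ vD v'D aa.
    by rewrite (disjointFr dV eV) in eV'.
  (* Without a forward segment every cycle arrow would run against [c], and the cycle would be
     oriented; the other direction is symmetric. *)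
  - apply: contra_notT nonor; rewrite has_map -all_predC => /allP nod; right.
    apply: cycle_from_next => // x xc.
    have /= := nod x xc; rewrite /d => dx.
    have [|[sE _]|[sE gE]] := aends x; rewrite -?cC //.
      by rewrite sE eqxx in dx.
    by have := arrow_gt0 (alpha x); rewrite sE gE.
  - apply: contra_notT nonor; rewrite has_map -all_predC => /allP nod; left.
    apply: cycle_from_next => // x xc.
    have /= := nod x xc; rewrite /d negbK => dx.
    have [|[sE gE]|[sE gE]] := aends x; rewrite -?cC //.
      by have := arrow_gt0 (alpha x); rewrite sE gE.
    by have := arrow_gt0 (alpha x); rewrite (eqP dx) gE arr_loopless.
have tD v : v \in c -> troot (t v) = if alpha v \in D then Some (z (alpha v)) else None.
  by move=> _; rewrite /t; case: ifP => // /trE[].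
have Dalpha a : a \in D -> exists2 v, v \in c & alpha v = a.
  by move=> /Dends[sC gC _]; have [v vC va] := asurj a sC gC; exists v; rewrite ?cC.
have ainj' : {in c &, injective alpha} by move=> u v; rewrite !cC; apply: ainj.
move=> x y; case: (boolP (x \in C)) => xC; case: (boolP (y \in C)) => yC.
(* Between cycle vertices only the totals over both directions are known to agree. Each circuit
   arrow comes from some [alpha w], so [circ] vanishes wherever [arr Q] does, and this settles each
   direction. *)
- have z0 u v : u \in C -> v \in C -> arr Q u v = 0 -> circ (circuit_of c d t) u v = 0.
    move=> uC vC uv; rewrite circ_in ?cC // big1_seq // => w /andP[_ wc].
    rewrite !segE //; case: eqP => // su; case: eqP => // tv.
    by have := arrow_gt0 (alpha w); rewrite su tv uv.
  have := @circ_nedges _ c d t uc tc x y; rewrite !cC => /(_ xC yC).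
  rewrite -nE // /nedges; case: (posnP (arr Q x y)) => [xy|/[dup] xy /arr_no2cycle yx].
    by rewrite xy z0.
  by rewrite yx (z0 y x) // !addn0.
- rewrite (CV x y xC yC).1 circ_from ?cC //.
  rewrite -(sum_exists (fun a => tgt a == x) y uc ainj' zinj Dalpha tD).
  by apply: eq_big_seq => v vc; rewrite segE.
- rewrite (CV y x yC xC).2 circ_to ?cC //.
  rewrite -(sum_exists (fun a => src a == y) x uc ainj' zinj Dalpha tD).
  by apply: eq_big_seq => v vc; rewrite segE.
rewrite circ_out ?cC //; move: xC yC; rewrite -!in_setC -!Vcov.
move=> /bigcupP[a aD xV] /bigcupP[b bD yV].
have [v vc va] := Dalpha a aD.
have tv : t v = tr a by rewrite /t va aD.
rewrite (sum_only (v0 := v)) // => [|u uc' uv]; last first.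
  rewrite tarr_notin //; apply/orP; left; apply/negP => /labV[uD xU].
  have ua : alpha u != a by rewrite -va; apply: contra_neq uv; apply: ainj'.
  by have [dV _] := Vdisj _ _ uD aD ua; rewrite (disjointFr dV xU) in xV.
rewrite tv; have [_ labE _ QE] := trE a aD.
have [ab|ab] := eqVneq a b; first by rewrite QE // ab.
have [dV ne] := Vdisj _ _ aD bD ab.
rewrite tarr_notin ?labE; last by rewrite (disjointFl dV yV) orbT.
by have := ne x y xV yV; rewrite /nedges; case: (arr Q x y).
Qed.

(** For uniqueness of the cycle, any non-oriented cycle avoids the trees, hence lies in [C], and
    [cycle_on_subset] then gives equality. *)
Lemma circuit_classQ n (T : finType) (Q : quiver T) w :
  #|T| = n.+1 -> connected Q -> circuit Q w -> classQ n Q.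
Proof.
move=> cardT cQ [aw all_w QE]; split=> //.
have /and3P[uw w_fwd w_bwd] := aw; have w2 := annular_size aw.
have uc : uniq [seq s.1.1 | s : segment T <- w].
  have fst_wlab (v : seq (segment T)) : {subset [seq s.1.1 | s <- v] <= wlab v}.
    elim: v => //= s v IH x; rewrite inE /wlab /= inE mem_cat.
    by case/orP => [->//|/IH xv]; rewrite [X in _ || X]orbC xv orbT.
  elim: (w) uw => //= s v IH; rewrite /wlab /= mem_cat negb_or.
  move=> /andP[/andP[_ sv]]; rewrite cat_uniq => /and3P[_ _ /IH ->]; rewrite andbT.
  by apply: contra sv; apply: fst_wlab.
have [d [t wE]] := circuit_of_fst uc.
move: [seq s.1.1 | s <- w] uc wE => c uc wE; subst w.
have c2 : 1 < size c by rewrite size_map in w2.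
move: (uw) (all_w); rewrite wlab_circuit_of => ufl all_fl.
have [uF /(_ uc) dF] := uniq_flatten_disj ufl.
have ut v : v \in c -> uniq (lab (t v)) by move=> /uF /= /andP[].
have tc : {in c, forall v, {in lab (t v), forall x, x \notin c}}.
  move=> v vc x xv; apply/negP => xc.
  have xv' : v != x by apply: contraTneq xv => <-; have /= /andP[] := uF v vc.
  have := dF v x vc xc xv' x; rewrite /= !inE xv orbT eqxx => /(_ isT) //.
have tdisj v v' x : v \in c -> v' \in c -> v != v' ->
    x \in lab (t v) -> x \notin lab (t v').
  move=> vc v'c vv' xv; have := dF v v' vc v'c vv' x.
  by rewrite !inE xv orbT negb_or => /(_ isT)/andP[].
pose C := [set x in c].
have cC : c =i C by move=> x; rewrite inE.
have cyc : cycle_on Q C c.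
  split; first by split.
  split=> [x y|]; first by rewrite -!cC /nedges !QE; apply: circ_nedges.
  rewrite !has_map in w_fwd w_bwd.
  have seg_gt0 v : v \in c -> 0 < arr Q (seg_src c d v) (seg_tgt c d v).
    by move=> vc; have /andP[sc gc] := seg_ends_mem d vc;
       rewrite QE circ_in // (bigD1_seq v) //= !eqxx.
  case=> /next_cycle H.
    case/hasP: w_bwd => v vc /= /negbTE dv; have := seg_gt0 v vc.
    by rewrite /seg_src /seg_tgt dv => /arr_no2cycle; have := H v vc => /= /[swap] ->.
  case/hasP: w_fwd => v vc /= dv; have := seg_gt0 v vc.
  by rewrite /seg_src /seg_tgt dv => /arr_no2cycle; have := H v vc => /= /[swap] ->.
have seg_gt0 v : v \in c -> 0 < arr Q (seg_src c d v) (seg_tgt c d v).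
  move=> vc; have /andP[sc gc] := seg_ends_mem d vc.
  by rewrite QE circ_in // (bigD1_seq v) //= !eqxx.
have [alpha [aends ainj asurj]] := cycle_on_arrows cyc.
have segE v : v \in c -> seg_src c d v = src (alpha v) /\ seg_tgt c d v = tgt (alpha v).
  move=> vc; have := seg_gt0 v vc; have := arrow_gt0 (alpha v).
  have := aends v; rewrite -cC => /(_ vc); rewrite /seg_src /seg_tgt.
  by case: ifP => _ [] [-> ->] // /arr_no2cycle ->.
(* Trees are transported from vertices to arrows along [alpha]; an arrow off the cycle receives the
   empty tree. *)
have trees a : exists ta, (forall v, v \in c -> alpha v = a -> ta = t v) /\
    (troot ta != None -> exists2 v, v \in c & alpha v = a).
  case: (boolP [exists v in c, alpha v == a]) => [/exists_inP[v vc /eqP va]|na].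
    exists (t v); split=> [u uc' ua|_]; last by exists v.
    by congr t; apply: ainj; rewrite -?cC // va.
  by exists E; split=> // v vc va; case/exists_inP: na; exists v; rewrite // va.
have [ta taE] := fin_all_exists trees.
have ta_alpha v : v \in c -> ta (alpha v) = t v.
  by move=> vc; apply: (taE (alpha v)).1.
pose D := [set a | troot (ta a) != None].
(* The default [src a] is taken only outside [D]. *)
pose z a := odflt (src a) (troot (ta a)).
pose V a := [set x in lab (ta a)].
have Dalpha a : a \in D -> exists2 v, v \in c & alpha v = a.
  by rewrite inE => /(taE a).2.
have rootE v : v \in c ->
    troot (t v) = if alpha v \in D then Some (z (alpha v)) else None.
  by move=> vc; rewrite inE /z ta_alpha //; case: (troot (t v)).
have z_lab a : a \in D -> z a \in lab (ta a).
  by rewrite inE /z; case r: (troot (ta a)) => [x|] // _; apply: root_lab.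
have zinj : {in D &, injective z}.
  move=> a b aD bD zab; have := z_lab b bD; rewrite -zab; have := z_lab a aD.
  move: (z a) => x.
  have [v vc <-] := Dalpha a aD; have [u uc' <-] := Dalpha b bD.
  rewrite !ta_alpha // => xv xu; congr alpha.
  by apply/eqP/negPn/negP => vu; move: (tdisj v u x vc uc' vu xv); rewrite xu.
have ainj' : {in c &, injective alpha} by move=> u v; rewrite !cC; apply: ainj.
have out_lab v x : v \in c -> x \notin c -> x \in lab (t v) ->
    forall y, y \notin c -> arr Q x y = tarr (t v) x y /\ arr Q y x = tarr (t v) y x.
  move=> vc xc xv y yc; rewrite !QE !circ_out //; split; apply: sum_only => // u uc' uv;
  rewrite eq_sym in uv; by rewrite tarr_notin // (tdisj v u x vc uc' uv xv) ?orbT.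
exists C; split.
  split; first by apply/nonoriented_cycleP; exists c.
  move=> C' /nonoriented_cycleP[c' cyc'].
  apply: (cycle_on_subset cyc cyc'); apply/subsetP => x xC'; rewrite -cC.
  have /flattenP[_ /mapP[v vc ->]] := all_fl x.
  rewrite inE => /predU1P[->//|xv]; exfalso; move: xC'; apply/negP.
  (* The attaching block is the 3-cycle on the cycle arrow: the root of the tree points to the
     source of that arrow and is reached from its target. *)
  apply: (tree_not_on_cycle (o1 := Some (seg_src c d v))
    (o2 := Some (seg_tgt c d v)) cyc' (ut v vc)) xv => [u y uv|? ? [<-] [<-]];
    last exact: seg_gt0.
  have uc' := tc v vc u uv.
  have /andP[sc gc] := seg_ends_mem d vc.
  have sum_v (f : T -> T) : \sum_(v0 <- c) ((f v0 == y) && (troot (t v0) == Some u)) =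
      (troot (t v) == Some u) && (Some (f v) == Some y).
    rewrite (sum_only (v0 := v)) // => [|v' v'c v'v]; first by rewrite andbC.
    rewrite root_notin ?andbF //; apply: (tdisj v) => //; by rewrite eq_sym.
  have [yc|yc] := boolP (y \in c).
    rewrite !QE circ_to // circ_from // !sum_v.
    by rewrite !tarr_notin // ?(contraL (tc v vc y) yc) ?orbT //.
  have [-> ->] := out_lab v u vc uc' uv y yc.
  have sy w : w \in c -> (Some w == Some y) = false.
    by move=> wc; apply: contraNF yc => /eqP[<-].
  by rewrite !sy // !andbF !addn0.
exists D, z, V; split; split.
- move=> a aD; have := z_lab a aD; have [v vc va] := Dalpha a aD.
  have := segE v vc; rewrite -va => -[<- <-]; rewrite ta_alpha // -!cC.
  by have /andP[-> ->] := seg_ends_mem d vc; move=> /tc-> //.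
- exact: zinj.
- move=> x w; rewrite -!cC => xc wc; rewrite !QE circ_from // circ_to //.
  rewrite -(sum_exists (fun a => tgt a == x) w uc ainj' zinj Dalpha rootE).
  rewrite -(sum_exists (fun a => src a == x) w uc ainj' zinj Dalpha rootE).
  by split; apply: eq_big_seq => v vc; have [eS eT] := segE v vc;
     rewrite ?eS ?eT.
- apply/setP => x; rewrite inE -cC; apply/bigcupP/idP => [[a aD]|xc].
    by have [v vc <-] := Dalpha a aD; rewrite inE ta_alpha //; apply: tc.
  have /flattenP[_ /mapP[v vc ->]] := all_fl x.
  rewrite inE => /predU1P[xv|xv]; first by rewrite xv vc in xc.
  exists (alpha v); last by rewrite inE ta_alpha.
  by rewrite inE ta_alpha //; case: (t v) xv.
- move=> a b aD bD; have [v vc <-] := Dalpha a aD; have [u uc' <-] := Dalpha b bD.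
  move=> ab; have vu : v != u by apply: contra_neq ab => ->.
  split.
    rewrite disjoint_subset; apply/subsetP => x; rewrite !inE !ta_alpha //.
    exact: tdisj.
  move=> x y; rewrite !inE !ta_alpha // => xv yu.
  have [e1 e2] := out_lab v x vc (tc v vc x xv) xv y (tc u uc' y yu).
  have yv : y \notin lab (t v) by apply: contraL yu => yv; apply: (tdisj v u).
  by rewrite /nedges e1 e2 !tarr_notin ?yv ?orbT.
- move=> a aD; have zV : z a \in V a by rewrite inE z_lab.
  exists (Sub (z a) zV); split; first by rewrite SubK.
  have [v vc va] := Dalpha a aD.
  have VE y : (y \in V a) = (y \in lab (t v)) by rewrite inE -va ta_alpha.
  have inV (x : {x : T | x \in V a}) : val x \in lab (t v).
    by rewrite -VE; apply: valP.
  have [t' t'E] : exists t' : btree {x : T | x \in V a}, tmap val t' = t v.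
    apply: tmap_lift => x xv; have xV : x \in V a by rewrite VE.
    by exists (Sub x xV); rewrite SubK.
  have lab' : map val (lab t') = lab (t v) by rewrite -lab_tmap t'E.
  apply: (@tree_rooted_typeA _ _ t'); split.
  + by rewrite -(map_inj_uniq val_inj) lab' ut.
  + move=> x; rewrite -(mem_map val_inj) lab'.
    exact: inV.
  + have := rootE v vc; rewrite va aD -t'E troot_tmap; case: (troot t') => //= y [yz].
    by congr Some; apply: val_inj; rewrite SubK.
  + move=> x y; rewrite /= /full_arr -(tarr_tmap t' x y val_inj) t'E.
    by have [-> _] := out_lab v _ vc (tc v vc _ (inV x)) (inV x) _ (tc v vc _ (inV y)).
Qed.

Theorem lemma3p5 (n : nat) (T : finType) (Q : quiver T) (i : T) :
  1 <= n -> classQ n Q -> classQ n (mutation Q i).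
Proof.
move=> _ cQ; have [cardT conn _] := cQ.
have [w /(circuit_mutation i)[w' cw']] := classQ_circuit cQ.
by apply: circuit_classQ cw' => //; apply: mutation_connected.
Qed.
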